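(* Let $p$ be a prime, $a\ge 1$, $R=\mathbb{Z}/p^a\mathbb{Z}$, and let $\xi$ be a probability distribution on $R$ that is not concentrated on an affine translate of a proper subring of $R$. For every $\epsilon>0$ there is a constant $C(\xi,a,\epsilon)$, depending only on $p,a,\xi,\epsilon$ (and not on $N$ or $k$), such that for all $N\ge1$ and $k\ge 1$ the following holds. Let - $\mathcal{G}_1,\dots,\mathcal{G}_k$ be $k$ independent copies of a Haar (uniformly) random element of $SL_N(\mathbb{Z}/p^a\mathbb{Z})$, - $\mathcal{U}_1,\dots,\mathcal{U}_k$ be $k$ independent copies of a Haar (uniformly) random element of $\mathrm{Mat}_{N,N}(\mathbb{Z}/p^a\mathbb{Z})$, - $\mathcal{M}_1,\dots,\mathcal{M}_k$ be $k$ independent random $N\times N$ matrices over $\mathbb{Z}/p^a\mathbb{Z}$, independent of the $\mathcal{G}_i$, each with independent entries of distribution $\xi$. Then the total variation distance between the joint distributions of the $k$-tuples satisfies $$d_{TV}\Big(\big[\mathcal{M}_1\mathcal{G}_1,\ \mathcal{G}_1^{-1}\mathcal{M}_2\mathcal{G}_2,\ \mathcal{G}_2^{-1}\mathcal{M}_3\mathcal{G}_3,\ \dots,\ \mathcal{G}_{k-1}^{-1}\mathcal{M}_k\mathcal{G}_k\big],\ \big[\mathcal{U}_1,\mathcal{U}_2,\mathcal{U}_3,\dots,\mathcal{U}_k\big]\Big)<k\,C(\xi,a,\epsilon)\,e^{\epsilon N}\,\big(\|\xi\bmod p\|_2\big)^N .$$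
   Context: $d_{TV}(X,Y)$ denotes the total variation distance between the distributions of the random variables $X$ and $Y$. $\|\xi\bmod p\|_2=\Big(\sum_{x\in\mathbb{Z}/p\mathbb{Z}}\Pr[\xi\equiv x \bmod p]^2\Big)^{1/2}$ is the $l^2$ norm of the distribution of the reduction of $\xi$ modulo $p$. An affine translate of a subring $S\subset R$ is a set of the form $\{us+b : s\in S\}$ with $u,b\in R$; subrings contain $1$. *)

(* Defs.v *)
(* MathComp; MathComp-Analysis is used only for [realType] and [expR]. *)
From HB Require Import structures.
From mathcomp Require Import all_boot all_order all_algebra.
From mathcomp Require Import reals sequences.

Set Implicit Arguments.
Unset Strict Implicit.
Unset Printing Implicit Defensive.

Import Order.TTheory GRing.Theory Num.Theory.
Local Open Scope ring_scope.

(* All random objects below take values in finite types; the distribution of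
   such an object is represented by its probability mass function. *)
Section FiniteProbability.

Variable R : realType.

Definition is_pmf (T : finType) (mu : {ffun T -> R}) : Prop :=
  (forall x, 0 <= mu x) /\ \sum_x mu x = 1.

Definition prob (T : finType) (mu : {ffun T -> R}) (A : {set T}) : R :=
  \sum_(x in A) mu x.

(* Distribution of the random variable [X] on the probability space
   [(W, mu)]. *)
Definition law (W T : finType) (mu : {ffun W -> R}) (X : W -> T) :
    {ffun T -> R} :=
  [ffun t => prob mu [set w | X w == t]].

Definition uniform (T : finType) (A : {set T}) : {ffun T -> R} :=
  [ffun x => if x \in A then #|A|%:R^-1 else 0].

(* Joint distribution of two independent variables. *)
Definition indep (S T : finType) (mu : {ffun S -> R}) (nu : {ffun T -> R}) :
    {ffun S * T -> R} :=
  [ffun w => mu w.1 * nu w.2].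

(* Joint distribution of [k] independent copies. *)
Definition iid (k : nat) (T : finType) (mu : {ffun T -> R}) :
    {ffun {ffun 'I_k -> T} -> R} :=
  [ffun f : {ffun 'I_k -> T} => \prod_i mu (f i)].

Definition iid_mx (N : nat) (A : finNzRingType) (xi : {ffun A -> R}) :
    {ffun 'M[A]_N -> R} :=
  [ffun M : 'M[A]_N => \prod_i \prod_j xi (M i j)].

(* Supremum over all events; the terms are nonnegative, so the default value
   [0] is harmless. *)
Definition dTV (T : finType) (mu nu : {ffun T -> R}) : R :=
  \big[Num.max/0]_(A : {set T}) `|prob mu A - prob nu A|.

Definition l2norm (T : finType) (mu : {ffun T -> R}) : R :=
  Num.sqrt (\sum_x mu x ^+ 2).

(* [mu] is concentrated on a set [u * S + b] with [S] a proper subring;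
   [subring_closed] includes [1 \in S]. *)
Definition concentrated_on_proper_affine_subring (A : finComNzRingType)
    (mu : {ffun A -> R}) : Prop :=
  exists (S : {set A}) (u b : A),
    [/\ subring_closed S, S \proper [set: A] &
        prob mu [set u * s + b | s in S] = 1].

End FiniteProbability.

Arguments uniform R {T} A.
Arguments iid {R} k {T} mu.
Arguments iid_mx {R} N {A} xi.

(* The canonical reduction Z/p^a -> Z/p, for [1 < p] and [0 < a]. *)
Definition reduce_mod (p a : nat) (x : 'Z_(p ^ a)) : 'Z_p := (val x)%:R.

Definition SL (N : nat) (A : finComUnitRingType) : {set 'M[A]_N} :=
  [set g : 'M[A]_N | \det g == 1].

Definition prev_ord (k : nat) (i : 'I_k) : 'I_k :=
  Ordinal (leq_ltn_trans (leq_pred i) (ltn_ord i)).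

(* The tuple [M_0 G_0, G_0^-1 M_1 G_1, ..., G_(k-2)^-1 M_(k-1) G_(k-1)],
   as a function of the pair of tuples [(M, G)]. *)
Definition twisted_tuple (N k : nat) (A : finComUnitRingType)
    (w : {ffun 'I_k -> 'M[A]_N} * {ffun 'I_k -> 'M[A]_N}) :
    {ffun 'I_k -> 'M[A]_N} :=
  let: (M, G) := w in
  [ffun i : 'I_k => if val i == 0%N then M i *m G i
                    else invmx (G (prev_ord i)) *m M i *m G i].

(* Main.v *)
(* Telescoping over the k factors reduces the theorem to one random matrix M
   tested against a function F invariant under right multiplication by SL_N: the
   product is twisted by Haar elements, and the factor after M may be taken
   uniform.  Telescoping again over the columns, one replaces a xi-distributed
   column by a uniform one.  Unipotent column operations average F over adding to
   this column the span of the others, so by Fourier inversion the error is at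
   most

     sum_(w <> 0) prod_i |hat xi (w_i)| * prod_(other columns c) P(w . c = 0).

   Split the frequencies w by the largest s for which fewer than m0 entries of w
   are outside p^s R.  There are few such w outside (p^s R)^N, and
   sum_(y in p^s R) |hat xi y| <= p^(a-s) q for s < a, with q = |xi mod p|_2, by
   Cauchy-Schwarz and Parseval; while P(w . c = 0) <= p^(s-a) + eta^m0, where
   eta < 1 bounds |hat xi| off 0.  The product of the two rates is q up to
   e^(eps/2).  For s = a the rates are 1 and P(w . c = 0) <= q.  All subrings
   of Z/p^a Z are trivial, so the only degenerate case is xi mod p constant,
   where q = 1 and there is nothing to prove. *)
Require Import Defs.
From mathcomp Require Import all_boot all_order all_algebra cyclic.
From mathcomp Require Import reals sequences exp.
From mathcomp Require Import separable cyclotomic complex ring lra zify.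

Set Implicit Arguments.
Unset Strict Implicit.
Unset Printing Implicit Defensive.

Import Order.TTheory GRing.Theory Num.Theory.
Local Open Scope ring_scope.

(** * Roots of unity, and sums of products over entries and columns *)

Lemma exists_prim_root (C : numClosedFieldType) (n : nat) :
  (0 < n)%N -> exists z : C, n.-primitive_root z.
Proof.
move=> n_gt0; pose q : {poly C} := 'X^n - 1.
have [r Dq] := closed_field_poly_normal q.
rewrite (monicP _) ?monicXnsubC // scale1r in Dq.
have r_unity : all n.-unity_root r.
  by apply/allP=> z; rewrite -root_prod_XsubC -Dq.
have sz_r : (n < (size r).+1)%N.
  by rewrite -(size_prod_XsubC r id) -Dq size_XnsubC.
have [|z] := hasP (has_prim_root n_gt0 r_unity _ sz_r); last by exists z.
(* The polynomial [X^n - 1] is separable in characteristic 0, so its [n] roots are distinct. *)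
by rewrite -separable_prod_XsubC -Dq separable_Xn_sub_1 // pnatr_eq0 -lt0n.
Qed.

Lemma exists_neq0_entry (A : nmodType) (m : nat) (w : 'rV[A]_m) :
  w != 0 -> exists i, w 0 i != 0.
Proof.
move=> w_neq0; apply/existsP; apply: contraNT w_neq0 => /existsPn w0.
by apply/eqP/rowP=> i; rewrite [RHS]mxE; apply/eqP/negPn/w0.
Qed.

Section ProductSums.

Variables (K : comNzRingType) (A : finType).

Lemma sum_prod_entries (N : nat) (g : 'I_N -> A -> K) :
  \sum_(c : 'cV[A]_N) \prod_i g i (c i 0) = \prod_i \sum_x g i x.
Proof.
rewrite bigA_distr_bigA /=.
rewrite (reindex (fun f : {ffun 'I_N -> A} => \col_i f i)) /=.
  by apply: eq_bigr => f _; apply: eq_bigr => i _; rewrite mxE.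
exists (fun c : 'cV[A]_N => [ffun i => c i 0]) => [f _ | c _].
  by apply/ffunP=> i; rewrite ffunE mxE.
by apply/colP=> i; rewrite mxE ffunE.
Qed.

Lemma sum_prod_col (m N : nat) (g : 'I_N -> 'cV[A]_m -> K) :
  \sum_X \prod_j g j (col j X) = \prod_j \sum_c g j c.
Proof.
rewrite bigA_distr_bigA /=.
rewrite (reindex (fun f : {ffun 'I_N -> 'cV[A]_m} => \matrix_(i, j) f j i 0)) /=.
  apply: eq_bigr => f _; apply: eq_bigr => j _; congr (g j _).
  by apply/colP=> i; rewrite !mxE.
exists (fun X : 'M[A]_(m, N) => [ffun j => col j X]) => [f _ | X _].
  by apply/ffunP=> j; apply/colP=> i; rewrite ffunE !mxE.
by apply/matrixP=> i j; rewrite mxE ffunE mxE.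
Qed.

End ProductSums.

(** * Fourier analysis on a finite commutative ring with a faithful additive character *)

Section Character.

Variables (C : numClosedFieldType) (A : finComNzRingType) (chi : A -> C).
Hypothesis chiD : forall x y, chi (x + y) = chi x * chi y.
Hypothesis norm_chi : forall x, `|chi x| = 1.
Hypothesis chi_neq1 : forall x, x != 0 -> chi x != 1.

Lemma chi0 : chi 0 = 1.
Proof.
have chi0_neq0 : chi 0 != 0 by rewrite -normr_gt0 norm_chi.
by apply: (mulfI chi0_neq0); rewrite -chiD addr0 mulr1.
Qed.

Lemma chi_sum (I : finType) (F : I -> A) : chi (\sum_i F i) = \prod_i chi (F i).
Proof. by apply: (big_morph chi chiD chi0). Qed.

(** If [r 0 j != 0], translating [x] by [delta_mx j 0] multiplies the sum by [chi (r 0 j) != 1],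
    which forces it to vanish. *)
Lemma sum_chi_col (m : nat) (r : 'rV[A]_m) :
  \sum_(x : 'cV[A]_m) chi ((r *m x) 0 0) = (#|A| ^ m)%:R *+ (r == 0).
Proof.
case: eqP => [-> | /eqP r_neq0].
  under eq_bigr do rewrite mul0mx mxE chi0.
  by rewrite sumr_const card_mx muln1 mulr1n.
have [j rj] := exists_neq0_entry r_neq0.
apply/eqP; set S := \sum__ _.
have : S = S * chi (r 0 j).
  rewrite {1}/S (reindex_inj (addIr (delta_mx j 0))) mulr_suml.
  apply: eq_bigr => x _; rewrite mulmxDr mxE chiD -colE.
  by congr (_ * chi _); rewrite mxE.
move/eqP; rewrite -subr_eq0 -{1}[S]mulr1 -mulrBr mulf_eq0.
by case/orP => //; rewrite subr_eq0 eq_sym (negPf (chi_neq1 rj)).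
Qed.

Definition hat (mu : A -> C) (y : A) : C := \sum_x mu x * chi (x * y).

Definition hat_col (N : nat) (D : 'cV[A]_N -> C) (w : 'rV[A]_N) : C :=
  \sum_c D c * chi ((w *m c) 0 0).

Lemma hat_col_inversion (N : nat) (D : 'cV[A]_N -> C) (c : 'cV[A]_N) :
  (#|A| ^ N)%:R * D c = \sum_w hat_col D w * chi (- (w *m c) 0 0).
Proof.
under eq_bigr do rewrite mulr_suml.
rewrite exchange_big /= (bigD1 c) //= [X in _ + X]big1 ?addr0 => [|c' neq_c'].
  under eq_bigr do rewrite -mulrA -chiD subrr chi0.
  by rewrite -mulr_sumr sumr_const card_mx mul1n mulrC.
under eq_bigr => w _.
  rewrite -mulrA -chiD.
  (* Transposing makes [w] the column that is summed over, so that [sum_chi_col] applies. *)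
  have -> : (w *m c') 0 0 - (w *m c) 0 0 = ((c' - c)^T *m w^T) 0 0.
    by rewrite -trmx_mul [RHS]mxE mulmxBr !mxE.
  over.
rewrite -mulr_sumr (reindex (fun x : 'cV[A]_N => x^T)) /=; last first.
  by exists trmx => x _; rewrite trmxK.
under eq_bigr do rewrite trmxK.
rewrite sum_chi_col (_ : _ == 0 = false) ?mulr0 //.
by rewrite -trmx0 (inj_eq trmx_inj) subr_eq0 (negPf neq_c').
Qed.

Lemma hat_col_prod (N : nat) (mu : 'I_N -> A -> C) (w : 'rV[A]_N) :
  hat_col (fun c => \prod_i mu i (c i 0)) w = \prod_i hat (mu i) (w 0 i).
Proof.
rewrite /hat_col /hat -sum_prod_entries; apply: eq_bigr => c _.
rewrite mxE chi_sum -big_split /=.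
by apply: eq_bigr => i _; rewrite [w 0 i * _]mulrC.
Qed.

(* Averaging over the translates by [X *m x] kills every Fourier coefficient at
   a frequency [w] that is not orthogonal to the columns of [X]. *)
Lemma sum_norm_average_le (N m : nat) (D : 'cV[A]_N -> C) (X : 'M[A]_(N, m)) :
  hat_col D 0 = 0 ->
  \sum_c `|\sum_(x : 'cV[A]_m) D (c + X *m x)| <=
    (#|A| ^ m)%:R * \sum_(w | (w != 0) && (w *m X == 0)) `|hat_col D w|.
Proof.
move=> D0.
have cardA_neq0 : (#|A| ^ N)%:R != 0 :> C.
  by rewrite pnatr_eq0 expn_eq0 (cardD1 0).
(* The bound is uniform in [c]: summing it over the [#|A| ^ N] vectors [c] cancels the factor
   introduced by Fourier inversion. *)
have pointwise c : (#|A| ^ N)%:R * `|\sum_(x : 'cV[A]_m) D (c + X *m x)| <=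
    (#|A| ^ m)%:R * \sum_(w | (w != 0) && (w *m X == 0)) `|hat_col D w|.
  rewrite -[X in X * `|_|]ger0_norm ?ler0n // -normrM mulr_sumr.
  under eq_bigr do rewrite hat_col_inversion.
  rewrite exchange_big /= (bigID (fun w => (w != 0) && (w *m X == 0))) /=.
  rewrite [X in _ + X]big1 ?addr0 => [|w].
    rewrite mulr_sumr; apply: le_trans (ler_norm_sum _ _ _) _.
    apply: ler_sum => w _; rewrite -mulr_sumr normrM mulrC.
    apply: ler_wpM2r => //; apply: le_trans (ler_norm_sum _ _ _) _.
    under eq_bigr do rewrite norm_chi.
    by rewrite sumr_const card_mx muln1.
  rewrite negb_and negbK => /orP[/eqP -> | wX].
    by under eq_bigr do rewrite D0 mul0r; rewrite big1.
  rewrite -mulr_sumr.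
  under eq_bigr => x _.
    rewrite mulmxDr mxE opprD chiD mulmxA -[- (w *m X *m x) 0 0]mulN1r.
    have -> : -1 * (w *m X *m x) 0 0 = (- (w *m X) *m x) 0 0.
      by rewrite mulNmx [RHS]mxE mulN1r.
    over.
  by rewrite -mulr_sumr sum_chi_col oppr_eq0 (negPf wX) !mulr0.
rewrite -(ler_pM2l (x := (#|A| ^ N)%:R)) ?lt0r ?cardA_neq0 ?ler0n //.
set B := (X in _ <= _ * X); rewrite mulr_sumr.
apply: (@le_trans _ _ (\sum_(c : 'cV[A]_N) B)).
  by apply: ler_sum => c _; apply: pointwise.
by rewrite sumr_const card_mx muln1 mulr_natl.
Qed.

Lemma sum_chi_mul (y : A) : \sum_(t : A) chi (t * y) = #|A|%:R *+ (y == 0).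
Proof.
have := sum_chi_col (const_mx y : 'rV_1); rewrite expn1.
have -> : (const_mx y == 0 :> 'rV_1) = (y == 0).
  apply/eqP/eqP => [/rowP/(_ 0) | ->]; first by rewrite !mxE.
  by apply/rowP=> i; rewrite !mxE.
move <-; rewrite (reindex (fun t : A => const_mx t : 'cV_1)) /=; last first.
  exists (fun c : 'cV_1 => c 0 0) => [t _ | c _]; first by rewrite mxE.
  by apply/colP=> i; rewrite mxE ord1.
by apply: eq_bigr => t _; rewrite mxE big_ord1 !mxE mulrC.
Qed.

(** The equation [w *m c = 0] is detected by summing the character over all multiples [t] of its
    left-hand side. *)
Lemma sum_orth_hat (N : nat) (mu : 'I_N -> A -> C) (w : 'rV[A]_N) :
  #|A|%:R * \sum_(c : 'cV[A]_N | (w *m c) 0 0 == 0) \prod_i mu i (c i 0) =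
  \sum_t \prod_i hat (mu i) (t * w 0 i).
Proof.
have hat_colE t : \prod_i hat (mu i) (t * w 0 i) =
    \sum_(c : 'cV[A]_N) \prod_i mu i (c i 0) * chi (t * (w *m c) 0 0).
  have := hat_col_prod mu (t *: w); rewrite /hat_col.
  under [in X in _ = X]eq_bigr do rewrite mxE.
  by move <-; apply: eq_bigr => c _; rewrite -scalemxAl mxE.
under [RHS]eq_bigr do rewrite hat_colE.
rewrite exchange_big /= big_mkcond mulr_sumr; apply: eq_bigr => c _.
by rewrite -mulr_sumr sum_chi_mul; case: eqP; rewrite ?mulr0 // mulrC.
Qed.

End Character.

(** * Telescoping of products *)

Definition mix (T : Type) (n : nat) (al be : 'I_n -> T) (m j : 'I_n) : T :=
  if (j < m)%N then al j else be j.

Lemma prodB_telescope (K : comNzRingType) (n : nat) (al be : 'I_n -> K) :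
  \prod_j al j - \prod_j be j =
  \sum_m (al m - be m) * \prod_(j | j != m) mix al be m j.
Proof.
elim: n al be => [|n IHn] al be; first by rewrite !big_ord0 subrr.
(* Splitting the last [al] leaves the earlier summands multiplied by [be ord_max], which is the
   value of [mix] there. *)
rewrite !big_ord_recr /= {1}(_ : al ord_max = al ord_max - be ord_max + be ord_max);
  last by rewrite subrK.
rewrite mulrDr -addrA -mulrBl IHn addrC mulr_suml; congr (_ + _).
  apply: eq_bigr => m _; rewrite -mulrA; congr (_ * _).
  rewrite [RHS]big_mkcond big_ord_recr /= -big_mkcond.
  have -> : (ord_max != widen_ord (leqnSn n) m).
    by rewrite -val_eqE /= neq_ltn ltn_ord orbT.
  by rewrite {3}/mix /= ltnNge ltnW.
rewrite mulrC; congr (_ * _).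
rewrite [RHS]big_mkcond big_ord_recr /= eqxx mulr1; apply: eq_bigr => j _.
by rewrite /mix /= ltn_ord -val_eqE /= neq_ltn ltn_ord.
Qed.

(** * One column tested against a function invariant under column operations *)

Section ColumnExchange.

Variables (C : numClosedFieldType) (A : finComUnitRingType) (chi : A -> C).
Hypothesis chiD : forall x y, chi (x + y) = chi x * chi y.
Hypothesis norm_chi : forall x, `|chi x| = 1.
Hypothesis chi_neq1 : forall x, x != 0 -> chi x != 1.

Variables (N : nat) (j0 : 'I_N).

(** Zeroing column [j0] rather than deleting it lets the coefficient vectors range over all of
    ['cV_N]. *)
Definition clear_col (X : 'M[A]_N) : 'M[A]_N :=
  \matrix_(i, j) if j == j0 then 0 else X i j.

(** Right multiplication by this matrix adds to column [j0] the combination of the other columns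
    with coefficients [x]; entry [j0] of [x] is discarded to keep the determinant 1. *)
Definition column_op (x : 'cV[A]_N) : 'M[A]_N :=
  1%:M + (\col_i if i == j0 then 0 else x i 0) *m delta_mx 0 j0.

Lemma column_opE x i j : column_op x i j =
  (i == j)%:R + if (i == j0) || (j != j0) then 0 else x i 0.
Proof.
rewrite !mxE big_ord1 !mxE /=; congr (_ + _).
by case: eqP => _; case: eqP => _; rewrite ?mul0r ?mulr0 ?mulr1.
Qed.

(** Row [j0] is a unit row, and the minor that remains after expanding along it is the identity. *)
Lemma det_column_op x : \det (column_op x) = 1.
Proof.
rewrite (expand_det_row _ j0) (bigD1 j0) //= big1 ?addr0 => [|j neq_j].
  rewrite column_opE !eqxx /= addr0 mul1r /cofactor -signr_odd addnn odd_double.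
  rewrite expr0 mul1r (_ : row' _ _ = 1%:M) ?det1 //; apply/matrixP=> i j.
  rewrite 2!mxE column_opE [RHS]mxE (inj_eq lift_inj).
  by rewrite [lift j0 j == j0]eq_sym neq_lift orbT addr0.
by rewrite column_opE eqxx [j0 == j]eq_sym (negPf neq_j) addr0 mul0r.
Qed.

Lemma col_mul_column_op X x j : col j (X *m column_op x) =
  col j X + if j == j0 then clear_col X *m x else 0.
Proof.
apply/colP=> i; rewrite mulmxDr mulmx1 mulmxA !mxE; congr (_ + _).
rewrite big_ord1 !mxE /= eq_sym; case: eqP => _; last by rewrite mulr0 mxE.
rewrite mulr1 !mxE; apply: eq_bigr => k _; rewrite !mxE.
by case: eqP => _; rewrite ?mulr0 ?mul0r.
Qed.

Lemma unitmx_det1 (h : 'M[A]_N) : \det h = 1 -> h \in unitmx.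
Proof. by rewrite unitmxE => ->; rewrite unitr1. Qed.

Variables (D : 'cV[A]_N -> C) (nu : 'I_N -> 'cV[A]_N -> C) (F : 'M[A]_N -> C).
Hypothesis D0 : hat_col chi D 0 = 0.
Hypothesis nu_ge0 : forall j c, 0 <= nu j c.
Hypothesis F_le1 : forall X, `|F X| <= 1.
Hypothesis F_inv : forall X h, \det h = 1 -> F (X *m h) = F X.

Let others X := \prod_(j | j != j0) nu j (col j X).

(** For each [x], the change of variables [X *m column_op x] fixes [F] and the other columns; the
    identity is the sum over all [x]. *)
Lemma sum_column_average :
  (#|A| ^ N)%:R * \sum_X D (col j0 X) * others X * F X =
  \sum_X others X * F X * \sum_(x : 'cV[A]_N) D (col j0 X + clear_col X *m x).
Proof.
have shift x : \sum_X D (col j0 X) * others X * F X =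
    \sum_X D (col j0 X + clear_col X *m x) * others X * F X.
  have hU := unitmx_det1 (det_column_op x).
  rewrite (reindex (fun X => X *m column_op x)) /=; last first.
    by exists (fun X => X *m invmx (column_op x)) => X _; rewrite (mulmxK, mulmxKV).
  apply: eq_bigr => X _; rewrite F_inv ?det_column_op // col_mul_column_op eqxx.
  congr (_ * _ * _); apply: eq_bigr => j neq_j.
  by rewrite col_mul_column_op (negPf neq_j) addr0.
under [RHS]eq_bigr do rewrite mulr_sumr.
rewrite exchange_big /=.
under [RHS]eq_bigr => x _.
  under eq_bigr do rewrite mulrC mulrA.
  rewrite -shift; over.
by rewrite sumr_const card_mx muln1 mulr_natl.
Qed.

(** Averaging leaves only the frequencies orthogonal to all other columns, and [F] is dropped since
    it is bounded by 1. Exchanging the sums then separates the columns. *)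
Lemma norm_sum_column_le :
  `|\sum_X D (col j0 X) * others X * F X| <=
  \sum_(w : 'rV[A]_N | w != 0) `|hat_col chi D w| *
     \prod_(j | j != j0) \sum_(c | (w *m c) 0 0 == 0) nu j c.
Proof.
set n := (#|A| ^ N)%:R : C.
have n_gt0 : 0 < n by rewrite ltr0n expn_gt0 (cardD1 0).
have others_ge0 X : 0 <= others X by apply: prodr_ge0 => j _; apply: nu_ge0.
pose T X c := \sum_(x : 'cV[A]_N) D (c + clear_col X *m x).
have le1 : n * `|\sum_X D (col j0 X) * others X * F X| <=
    \sum_X others X * `|T X (col j0 X)|.
  rewrite -[X in X * _](gtr0_norm n_gt0) -normrM sum_column_average.
  apply: le_trans (ler_norm_sum _ _ _) (ler_sum _ _) => X _.
  rewrite !normrM (ger0_norm (others_ge0 X)) -mulrA ler_wpM2l //.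
  by rewrite ler_piMl.
(* Neither [others] nor [clear_col] sees column [j0], so translating that column by every [c] turns
   the factor [n] into a full sum over [c]. *)
have le2 : n * \sum_X others X * `|T X (col j0 X)| <= n * \sum_X others X *
    \sum_(w | (w != 0) && (w *m clear_col X == 0)) `|hat_col chi D w|.
  pose add (c : 'cV[A]_N) (X : 'M[A]_N) := X + c *m delta_mx 0 j0.
  have col_add c X j : col j (add c X) = col j X + if j == j0 then c else 0.
    apply/colP=> i; rewrite !mxE big_ord1 !mxE /= eq_sym.
    by case: eqP => _; rewrite ?mulr0 ?mulr1 // mxE.
  have -> : n * \sum_X others X * `|T X (col j0 X)| =
      \sum_X others X * \sum_c `|T X c|.
    transitivity (\sum_(c : 'cV[A]_N) \sum_X others X * `|T X (col j0 X)|).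
      by rewrite sumr_const card_mx muln1 mulr_natl.
    transitivity (\sum_(c : 'cV[A]_N) \sum_X others X * `|T X (col j0 X + c)|).
      apply: eq_bigr => c _.
      rewrite (reindex_inj (addIr (c *m delta_mx 0 j0))) /=.
      apply: eq_bigr => X _; rewrite -/(add c X) col_add eqxx; congr (_ * _).
        by apply: eq_bigr => j /negPf neq_j; rewrite col_add neq_j addr0.
      rewrite /T; congr (`|_|); apply: eq_bigr => x _; congr (D (_ + _ *m _)).
      apply/matrixP=> i j.
      rewrite !mxE; case: eqP => // /eqP neq_j.
      by rewrite big_ord1 !mxE (negPf neq_j) mulr0 addr0.
    rewrite exchange_big; apply: eq_bigr => X _; rewrite -mulr_sumr.
    by congr (_ * _); rewrite [RHS](reindex_inj (addrI (col j0 X))).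
  rewrite mulr_sumr; apply: ler_sum => X _; rewrite mulrCA ler_wpM2l //.
  exact: (sum_norm_average_le chiD norm_chi chi_neq1 (clear_col X) D0).
rewrite -(ler_pM2l n_gt0); apply: le_trans le1 _.
rewrite -(ler_pM2l n_gt0); apply: le_trans le2 _.
rewrite ler_pM2l // le_eqVlt; apply/orP; left; apply/eqP.
under eq_bigr do rewrite mulr_sumr big_mkcondr.
rewrite exchange_big mulr_sumr /=; apply: eq_bigr => w _.
(* Orthogonality to [clear_col X] is a condition on each column separately, so the sum over [X]
   factors; the unconstrained column [j0] contributes [n]. *)
transitivity (`|hat_col chi D w| * \sum_(X : 'M[A]_N) \prod_j
    if j == j0 then 1 else if (w *m col j X) 0 0 == 0 then nu j (col j X) else 0).
  rewrite mulr_sumr; apply: eq_bigr => X _.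
  rewrite [in RHS](bigD1 j0) //= eqxx mul1r.
  case: eqP => [wX | /eqP wX].
    rewrite mulrC /others; congr (_ * _); apply: eq_bigr => j neq_j.
    move/rowP/(_ j): wX; rewrite (negPf neq_j) !mxE => wX.
    rewrite (_ : \sum__ _ = 0) ?eqxx // -[RHS]wX; apply: eq_bigr => i _.
    by rewrite !mxE (negPf neq_j).
  have [j wj] := exists_neq0_entry wX.
  have neq_j : j != j0.
    apply: contraNneq wj => ->; rewrite mxE big1 // => i _.
    by rewrite mxE eqxx mulr0.
  rewrite (bigD1 j) //= (negPf neq_j) (_ : (w *m col j X) 0 0 == 0 = false).
    by rewrite mul0r mulr0.
  apply/negbTE; apply: contraNneq wj => <-; rewrite !mxE; apply/eqP.
  by apply: eq_bigr => i _; rewrite !mxE (negPf neq_j).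
rewrite (sum_prod_col (fun j c =>
  if j == j0 then 1 else if (w *m c) 0 0 == 0 then nu j c else 0)).
rewrite (bigD1 j0) //= eqxx sumr_const card_mx muln1 mulrCA; congr (_ * (_ * _)).
by apply: eq_bigr => j /negPf ->; rewrite -big_mkcond.
Qed.

End ColumnExchange.

(** Cauchy-Schwarz against the constant 1, from [2xy <= x^2 + y^2]. *)
Lemma sqr_sum_le (R : realFieldType) (I : finType) (P : pred I) (F : I -> R) :
  (\sum_(i | P i) F i) ^+ 2 <= #|P|%:R * \sum_(i | P i) F i ^+ 2.
Proof.
rewrite expr2 mulr_suml.
under eq_bigr do rewrite mulr_sumr.
apply: (@le_trans _ _ (\sum_(i | P i) \sum_(j | P j)
    (F i ^+ 2 / 2 + F j ^+ 2 / 2))).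
  apply: ler_sum => i _; apply: ler_sum => j _.
  by have := sqr_ge0 (F i - F j); lra.
under eq_bigr do rewrite big_split /= sumr_const -mulr_suml.
rewrite big_split /= sumr_const sumrMnl -mulr_suml -mulrnDl.
by rewrite -splitr mulr_natl.
Qed.

(** * Divisibility by powers of [p] in Z/p^a Z *)

Section PrimePowerRing.

Variables (p a : nat).
Hypotheses (p_pr : prime p) (a_gt0 : (0 < a)%N).

Local Notation A := 'Z_(p ^ a).

Lemma modulus_gt1 : (1 < p ^ a)%N.
Proof.
apply: leq_trans (prime_gt1 p_pr) _.
by rewrite -[X in (X <= _)%N]expn1 leq_exp2l ?prime_gt1.
Qed.

(** Membership in the ideal [p^s R], tested on the representative below [p^a]; for [s <= a] any
    representative gives the same answer. *)
Definition pdvd (s : nat) (x : A) : bool := (p ^ s %| x)%N.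

Lemma pdvd_nat s m : (s <= a)%N -> pdvd s m%:R = (p ^ s %| m)%N.
Proof.
move=> le_sa; rewrite /pdvd val_Zp_nat ?modulus_gt1 //.
by rewrite /dvdn modn_dvdm ?dvdn_exp2l.
Qed.

Lemma pdvdD s x y : (s <= a)%N -> pdvd s x -> pdvd s (x + y) = pdvd s y.
Proof.
move=> le_sa sx; rewrite -{1}(natr_Zp x) -{1}(natr_Zp y) -natrD pdvd_nat //.
by rewrite dvdn_addr.
Qed.

Lemma pdvd0 x : pdvd 0 x.
Proof. by rewrite /pdvd dvd1n. Qed.

Lemma pdvdN s x : (s <= a)%N -> pdvd s (- x) = pdvd s x.
Proof.
move=> le_sa; have pdvdNr y : pdvd s y -> pdvd s (- y).
  by move=> sy; rewrite -(pdvdD _ le_sa sy) subrr /pdvd dvdn0.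
by apply/idP/idP => /pdvdNr //; rewrite opprK.
Qed.

Lemma ltn_modulus (x : A) : (x < p ^ a)%N.
Proof. by have := ltn_ord x; rewrite [in X in (_ < X)%N]Zp_cast ?modulus_gt1. Qed.

Lemma pdvd_top x : pdvd a x = (x == 0).
Proof.
apply/idP/eqP => [ax | ->]; last by rewrite /pdvd dvdn0.
apply/val_inj => /=; move: ax; rewrite /pdvd /dvdn modn_small ?ltn_modulus //.
by move/eqP.
Qed.

(** Valuations add: [w] has valuation at most [s] and [t] less than [a - s], so the product has
    valuation less than [a]. *)
Lemma mul_neq0 s t w : (s < a)%N -> ~~ pdvd s.+1 w -> ~~ pdvd (a - s) t ->
  t * w != 0.
Proof.
move=> lt_sa sw st; rewrite -pdvd_top -(natr_Zp t) -(natr_Zp w) -natrM pdvd_nat //.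
have w_gt0 : (0 < w)%N.
  by rewrite lt0n; apply: contraNneq sw => w0; rewrite /pdvd w0 dvdn0.
have t_gt0 : (0 < t)%N.
  by rewrite lt0n; apply: contraNneq st => t0; rewrite /pdvd t0 dvdn0.
move: sw st; rewrite /pdvd !(pfactor_dvdn _ p_pr) ?muln_gt0 ?t_gt0 ?w_gt0 //.
by rewrite lognM //; lia.
Qed.

Lemma card_pdvd s : (s <= a)%N -> (#|pdvd s| <= p ^ (a - s))%N.
Proof.
move=> le_sa; have p_gt0 := prime_gt0 p_pr.
have lt_q (x : A) : (x %/ p ^ s < p ^ (a - s))%N.
  by rewrite ltn_divLR ?expn_gt0 ?p_gt0 // -expnD subnK // ltn_modulus.
have q_inj : {in pdvd s &, injective (fun x => Ordinal (lt_q x))}.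
  move=> x y sx sy [] eq_q; apply/val_inj.
  by rewrite /= -(divnK sx) -(divnK sy) eq_q.
by rewrite -[X in (_ <= X)%N]card_ord -(card_in_image q_inj) max_card.
Qed.

Lemma reduce_mod_eq x y :
  (@reduce_mod p a x == @reduce_mod p a y) = pdvd 1 (x - y).
Proof.
rewrite /reduce_mod -val_eqE /= !val_Zp_nat ?prime_gt1 //.
have p_dvd : (p %| p ^ a)%N by rewrite -{1}(expn1 p) dvdn_exp2l.
have -> : x - y = (x + (p ^ a - y))%:R.
  rewrite natrD natrB ?(ltnW (ltn_modulus y)) // !natr_Zp.
  by rewrite pchar_Zp ?modulus_gt1 // sub0r.
rewrite pdvd_nat // expn1 -(eqn_modDr (p ^ a - y)) subnKC ?(ltnW (ltn_modulus y)) //.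
by rewrite (eqP p_dvd) /dvdn.
Qed.

(** * The reduction of [xi] modulo [p] and its l2 norm *)

Section Measure.

Variables (R : realType) (xi : {ffun A -> R}).
Hypothesis xi_pmf : is_pmf xi.

Local Notation q := (l2norm (law xi (@reduce_mod p a))).

Let xi_ge0 x : 0 <= xi x. Proof. by case: xi_pmf. Qed.
Let xi_sum1 : \sum_x xi x = 1. Proof. by case: xi_pmf. Qed.

Lemma law_ge0 z : 0 <= law xi (@reduce_mod p a) z.
Proof. by rewrite ffunE; apply: sumr_ge0. Qed.

Lemma law_reduce_mod y :
  law xi (@reduce_mod p a) (reduce_mod y) = \sum_(x | pdvd 1 (x - y)) xi x.
Proof. by rewrite ffunE; apply: eq_bigl => x; rewrite inE reduce_mod_eq. Qed.

Lemma sum_law : \sum_z law xi (@reduce_mod p a) z = 1.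
Proof.
rewrite -xi_sum1 (partition_big (@reduce_mod p a) xpredT) //=.
by apply: eq_bigr => z _; rewrite ffunE; apply: eq_bigl => x; rewrite inE.
Qed.

Lemma l2norm_sqr : q ^+ 2 = \sum_z law xi (@reduce_mod p a) z ^+ 2.
Proof. by rewrite sqr_sqrtr // sumr_ge0 // => z _; apply: sqr_ge0. Qed.

(** The collision probability of two independent samples modulo [p], the form in which Parseval
    produces [q ^+ 2]. *)
Lemma l2norm_sqr_pairs :
  q ^+ 2 = \sum_x \sum_(y | pdvd 1 (x - y)) xi x * xi y.
Proof.
rewrite l2norm_sqr [RHS](partition_big (@reduce_mod p a) xpredT) //=.
apply: eq_bigr => z _; rewrite expr2 {1}ffunE /prob mulr_suml.
apply: eq_big => [x | x]; rewrite inE // => /eqP <-.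
rewrite law_reduce_mod mulr_sumr; apply: eq_bigl => y.
by rewrite -(pdvdN _ a_gt0) opprB.
Qed.

Lemma law_le_l2norm z : law xi (@reduce_mod p a) z <= q.
Proof.
rewrite -(ler_pXn2r (n := 2)) ?nnegrE ?sqrtr_ge0 ?law_ge0 //.
by rewrite l2norm_sqr (bigD1 z) //= lerDl sumr_ge0 // => y _; apply: sqr_ge0.
Qed.

Lemma class_mass_le y : \sum_(x | pdvd 1 (x - y)) xi x <= q.
Proof. by rewrite -law_reduce_mod law_le_l2norm. Qed.

(** Cauchy-Schwarz gives [1 <= p * q^2]; the bound is weakened to [p^-1] to avoid the square root of
    [p]. *)
Lemma inv_prime_le_l2norm : p%:R^-1 <= q.
Proof.
have p_gt0 : 0 < p%:R :> R by rewrite ltr0n prime_gt0.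
have card_p : #|(xpredT : pred 'Z_p)| = p.
  by rewrite -[RHS]Zp_cast ?prime_gt1 // -[RHS]card_ord; apply: eq_card.
have := sqr_sum_le xpredT (law xi (@reduce_mod p a)).
rewrite sum_law expr1n -l2norm_sqr card_p => le1.
rewrite -(ler_pXn2r (n := 2)) ?nnegrE ?sqrtr_ge0 ?invr_ge0 ?ler0n //.
rewrite exprVn -div1r ler_pdivrMr ?exprn_gt0 // mulrC expr2 -mulrA.
apply: le_trans le1 _; rewrite ler_peMl ?mulr_ge0 ?sqrtr_ge0 ?ler0n //.
by rewrite ler1n prime_gt0.
Qed.

Lemma l2norm_gt0 : 0 < q.
Proof.
by apply: lt_le_trans inv_prime_le_l2norm; rewrite invr_gt0 ltr0n prime_gt0.
Qed.

Lemma law_le1 z : law xi (@reduce_mod p a) z <= 1.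
Proof. by rewrite -sum_law (bigD1 z) //= lerDl sumr_ge0 // => y _; apply: law_ge0. Qed.

Lemma l2norm_le1 : q <= 1.
Proof.
rewrite -(ler_pXn2r (n := 2)) ?nnegrE ?sqrtr_ge0 // expr1n l2norm_sqr -sum_law.
by apply: ler_sum => z _; rewrite expr2 ler_piMl ?law_ge0 ?law_le1.
Qed.

(** Otherwise the class of [x] modulo [p] would have mass 1, forcing [q >= 1]. *)
Lemma exists_far_point x : q < 1 -> exists2 y, 0 < xi y & ~~ pdvd 1 (y - x).
Proof.
move=> q_lt1.
have : [exists y, (0 < xi y) && ~~ pdvd 1 (y - x)]; last first.
  by case/existsP=> y /andP[]; exists y.
apply: contraTT q_lt1 => /existsPn far; rewrite -leNgt.
rewrite -xi_sum1 (bigID (fun y => pdvd 1 (y - x))) /= [X in _ + X]big1.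
  by rewrite addr0 class_mass_le.
move=> y yx; have := far y; rewrite yx andbT -leNgt => xi_le0.
by apply/eqP; rewrite eq_le xi_le0 xi_ge0.
Qed.

End Measure.
End PrimePowerRing.

(** * Characters of Z/nZ and moduli of Fourier coefficients *)

Lemma exists_character (C : numClosedFieldType) (n : nat) : (1 < n)%N ->
  exists chi : 'Z_n -> C, [/\ forall x y, chi (x + y) = chi x * chi y,
    forall x, `|chi x| = 1 & forall x, x != 0 -> chi x != 1].
Proof.
move=> n_gt1; have n_gt0 := ltnW n_gt1.
have [z z_prim] := exists_prim_root C n_gt0.
exists (fun x : 'Z_n => z ^+ x); split=> [x y | x | x].
- have valD : nat_of_ord (x + y) = ((x + y)%N %% n)%N.
    by rewrite -val_Zp_nat // natrD !natr_Zp.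
  by rewrite valD (prim_expr_mod z_prim) exprD.
- apply/eqP; rewrite normrX -(eqrXn2 n_gt0) ?exprn_ge0 // expr1n -exprM mulnC.
  by rewrite exprM -normrX (prim_expr_order z_prim) normr1 expr1n.
- apply: contraNneq => /eqP; rewrite -(expr0 z) (eq_prim_root_expr z_prim).
  rewrite mod0n modn_small => [/eqP x0 | ]; first exact/eqP/val_inj.
  by have := ltn_ord x; rewrite [in X in (_ < X)%N]Zp_cast.
Qed.

Section AbsoluteTransform.

Variables (R : realType) (p a : nat).
Hypotheses (p_pr : prime p) (a_gt0 : (0 < a)%N).

Local Notation A := 'Z_(p ^ a).
Local Notation C := R[i].
Local Open Scope complex_scope.

Variable chi : A -> C.
Hypothesis chiD : forall x y, chi (x + y) = chi x * chi y.
Hypothesis norm_chi : forall x, `|chi x| = 1.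
Hypothesis chi_neq1 : forall x, x != 0 -> chi x != 1.

(** The modulus in [R[i]] is again an element of [R[i]]; its real part carries the estimates over to
    [R]. *)
Definition abs_hat (mu : {ffun A -> R}) (y : A) : R :=
  complex.Re `|hat chi (fun x => (mu x)%:C) y|.

Lemma abs_hatE mu y : (abs_hat mu y)%:C = `|hat chi (fun x => (mu x)%:C) y|.
Proof. by rewrite RRe_real ?normr_real. Qed.

Lemma abs_hat_ge0 mu y : 0 <= abs_hat mu y.
Proof. by rewrite -lecR abs_hatE normr_ge0. Qed.

Lemma card_ring : #|A| = (p ^ a)%N.
Proof. by rewrite card_ord Zp_cast ?modulus_gt1. Qed.

Lemma sum_prod_orth_le (N : nat) (mu : 'I_N -> {ffun A -> R}) (w : 'rV[A]_N) :
  (p ^ a)%:R * \sum_(c : 'cV[A]_N | (w *m c) 0 0 == 0) \prod_i mu i (c i 0) <=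
  \sum_t \prod_i abs_hat (mu i) (t * w 0 i).
Proof.
set L := _ * _; have -> : \sum_t \prod_i abs_hat (mu i) (t * w 0 i) =
    complex.Re (\sum_t `|\prod_i hat chi (fun x => (mu i x)%:C) (t * w 0 i)|).
  apply: complexI; rewrite RRe_real ?realE ?sumr_ge0 // rmorph_sum.
  apply: eq_bigr => t _; rewrite normr_prod rmorph_prod.
  by apply: eq_bigr => i _; apply: abs_hatE.
rewrite -lecR RRe_real ?realE ?sumr_ge0 //.
apply: le_trans (ler_norm_sum _ _ _).
rewrite -(sum_orth_hat chiD norm_chi chi_neq1) card_ring.
have <- : L%:C = (p ^ a)%:R * \sum_(c : 'cV[A]_N | (w *m c) 0 0 == 0)
    \prod_i (mu i (c i 0))%:C.
  rewrite /L rmorphM rmorph_nat rmorph_sum; congr (_ * _).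
  by apply: eq_bigr => c _; rewrite rmorph_prod.
by rewrite real_ler_norm // complex_real.
Qed.

Variable mu : {ffun A -> R}.
Hypothesis mu_pmf : is_pmf mu.

Local Notation q := (l2norm (law mu (@reduce_mod p a))).

Let mu_ge0 x : 0 <= mu x. Proof. by case: mu_pmf. Qed.
Let mu_sum1 : \sum_x mu x = 1. Proof. by case: mu_pmf. Qed.

Lemma abs_hat_le1 y : abs_hat mu y <= 1.
Proof.
rewrite -lecR abs_hatE; apply: le_trans (ler_norm_sum _ _ _) _.
rewrite -[X in _ <= X%:C]mu_sum1 rmorph_sum; apply: ler_sum => x _ /=.
by rewrite normrM norm_chi mulr1 ger0_norm // ler0c.
Qed.

Lemma abs_hat0 : abs_hat mu 0 = 1.
Proof.
apply: complexI; rewrite abs_hatE /hat -[1 in RHS]mu_sum1 rmorph_sum.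
under eq_bigr do rewrite mulr0 (chi0 chiD norm_chi) mulr1.
rewrite -rmorph_sum ger0_norm //.
by rewrite ler0c sumr_ge0.
Qed.

(** Equality in the triangle inequality makes [chi (x * y)] constant on the support. For [q < 1] the
    support has two points differing by a unit, so [chi] would be 1 at a nonzero element. *)
Lemma abs_hat_lt1 y : q < 1 -> y != 0 -> abs_hat mu y < 1.
Proof.
move=> q_lt1 y_neq0; rewrite lt_neqAle abs_hat_le1 andbT; apply/eqP=> abs1.
have eq_norm : `|\sum_x (mu x)%:C * chi (x * y)| =
    \sum_x `|(mu x)%:C * chi (x * y)|.
  rewrite -[LHS]abs_hatE abs1 -mu_sum1 rmorph_sum; apply: eq_bigr => x _ /=.
  by rewrite normrM norm_chi mulr1 ger0_norm // ler0c.
have [t _ tP] := normC_sum_eq eq_norm.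
have chiE x : 0 < mu x -> chi (x * y) = t.
  move=> x_gt0; have := tP x isT; rewrite normrM norm_chi mulr1 ger0_norm ?ler0c //.
  by apply: mulfI; rewrite -(rmorph0 (real_complex R)) (inj_eq (@complexI _)) gt_eqF.
have [x x_gt0 _] := exists_far_point p_pr a_gt0 mu_pmf 0 q_lt1.
have [z z_gt0 zx] := exists_far_point p_pr a_gt0 mu_pmf x q_lt1.
have zxy : (z - x) * y != 0.
  apply: (mul_neq0 p_pr a_gt0 (s := a.-1)); rewrite ?prednK ?pdvd_top //.
  by have -> : (a - a.-1 = 1)%N by case: (a) a_gt0 => // b _; rewrite subSnn.
have /eqP := chi_neq1 zxy; apply.
have t_neq0 : t != 0 by rewrite -(chiE x x_gt0) -normr_gt0 norm_chi.
by apply: (mulIf t_neq0); rewrite mul1r -{1}(chiE x x_gt0) -chiD -mulrDl subrK chiE.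
Qed.

(** The sum over the ideal [p^s R] vanishes unless [t] annihilates the ideal; as [s < a], this
    forces [p] to divide [t]. *)
Lemma sum_chi_pdvd s t : (s < a)%N ->
  \sum_(y | pdvd s y) chi (t * y) <= (p ^ (a - s))%:R *+ pdvd 1 t.
Proof.
move=> lt_sa; have le_sa := ltnW lt_sa.
have sum0 y0 : pdvd s y0 -> t * y0 != 0 -> \sum_(y | pdvd s y) chi (t * y) = 0.
  move=> sy0 ty0; set S := \sum_(_ | _) _; apply/eqP.
  have : S = S * chi (t * y0).
    rewrite {1}/S (reindex_inj (addrI y0)) mulr_suml /=.
    apply: eq_big => [y | y _]; first by rewrite pdvdD.
    by rewrite mulrDr chiD mulrC.
  move/eqP; rewrite -subr_eq0 -{1}[S]mulr1 -mulrBr mulf_eq0.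
  by case/orP => //; rewrite subr_eq0 eq_sym (negPf (chi_neq1 ty0)).
have [/existsP[y0 /andP[sy0 ty0]] | /existsPn all0] :=
    boolP [exists y, pdvd s y && (t * y != 0)].
  by rewrite (sum0 y0) // mulrn_wge0.
have -> : pdvd 1 t.
  apply: contraT => t1; have := all0 (p ^ s)%:R.
  rewrite pdvd_nat // dvdnn negbK mulrC => /eqP t0.
  have ps : ~~ pdvd (a - 0) ((p ^ s)%:R : A).
    by rewrite subn0 pdvd_nat // dvdn_Pexp2l ?prime_gt1 // -ltnNge.
  by have := mul_neq0 p_pr a_gt0 a_gt0 t1 ps; rewrite t0 eqxx.
under eq_bigr => y sy.
  have := all0 y; rewrite sy negbK => /eqP ->; rewrite (chi0 chiD norm_chi); over.
by rewrite sumr_const mulr1n ler_nat card_pdvd.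
Qed.

(** Parseval on an ideal: in the expanded square, summing over [y] keeps only pairs congruent modulo
    [p], whose total mass is [q ^+ 2]. *)
Lemma sum_abs_hat_sqr_le s : (s < a)%N ->
  \sum_(y | pdvd s y) abs_hat mu y ^+ 2 <= (p ^ (a - s))%:R * q ^+ 2.
Proof.
move=> lt_sa; rewrite -lecR rmorph_sum.
have sqrE y : ((abs_hat mu y) ^+ 2)%:C =
    \sum_x \sum_z (mu x * mu z)%:C * chi ((x - z) * y).
  have conj_chi z : Num.conj (chi z) = chi (- z).
    have chi_neq0 : chi z != 0 by rewrite -normr_gt0 norm_chi.
    apply: (mulfI chi_neq0); rewrite -chiD subrr (chi0 chiD norm_chi).
    by rewrite -normCK norm_chi expr1n.
  have conj_term z : Num.conj ((mu z)%:C * chi (z * y)) = (mu z)%:C * chi (- (z * y)).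
    rewrite -conj_chi -{2}(_ : Num.conj (mu z)%:C = (mu z)%:C) -?rmorphM //.
    by rewrite conj_Creal // ger0_real // ler0c.
  have conj_hat : Num.conj (hat chi (fun x => (mu x)%:C) y) =
      \sum_z (mu z)%:C * chi (- (z * y)).
    by rewrite rmorph_sum; apply: eq_bigr => z _; apply: conj_term.
  rewrite rmorphXn /= abs_hatE normCK conj_hat mulr_suml.
  apply: eq_bigr => x _; rewrite mulr_sumr; apply: eq_bigr => z _.
  by rewrite mulrBl chiD [in RHS]rmorphM mulrACA.
rewrite (eq_bigr _ (fun y _ => sqrE y)).
rewrite exchange_big /=.
under eq_bigr do rewrite exchange_big /=.
rewrite (l2norm_sqr_pairs p_pr a_gt0) // rmorphM rmorph_nat rmorph_sum mulr_sumr.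
apply: ler_sum => x _; rewrite [X in _ * X]rmorph_sum mulr_sumr.
rewrite [leRHS]big_mkcond; apply: ler_sum => z _; rewrite -mulr_sumr /=.
have xz_ge0 : 0 <= (mu x * mu z)%:C :> C by rewrite ler0c mulr_ge0.
apply: le_trans (ler_wpM2l xz_ge0 (sum_chi_pdvd _ lt_sa)) _.
by case: ifP; rewrite ?mulr0 // mulrC.
Qed.

Lemma sum_abs_hat_le s : (s < a)%N ->
  \sum_(y | pdvd s y) abs_hat mu y <= (p ^ (a - s))%:R * q.
Proof.
move=> lt_sa.
have q_ge0 : 0 <= q := sqrtr_ge0 _.
rewrite -(ler_pXn2r (n := 2)) ?nnegrE ?mulr_ge0 ?ler0n ?sumr_ge0 //; last first.
  by move=> y _; apply: abs_hat_ge0.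
apply: le_trans (sqr_sum_le _ _) _; rewrite exprMn expr2 -mulrA.
apply: ler_pM; rewrite ?ler0n ?sumr_ge0 ?ler_nat ?card_pdvd ?(ltnW lt_sa) //.
- by move=> y _; apply: sqr_ge0.
- exact: sum_abs_hat_sqr_le.
Qed.

End AbsoluteTransform.

Lemma sum_prod_row (K : comNzRingType) (A : finType) (N : nat) (g : 'I_N -> A -> K) :
  \sum_(w : 'rV[A]_N) \prod_i g i (w 0 i) = \prod_i \sum_x g i x.
Proof.
rewrite -sum_prod_entries (reindex (fun c : 'cV[A]_N => c^T)) /=; last first.
  by exists trmx => x _; rewrite trmxK.
by apply: eq_bigr => c _; apply: eq_bigr => i _; rewrite mxE.
Qed.

(** * Hyperplane masses and stratification of the frequencies *)

Section Strata.

Variables (R : realType) (p a : nat).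
Hypotheses (p_pr : prime p) (a_gt0 : (0 < a)%N).

Local Notation A := 'Z_(p ^ a).

Variable chi : A -> R[i].
Hypothesis chiD : forall x y, chi (x + y) = chi x * chi y.
Hypothesis norm_chi : forall x, `|chi x| = 1.
Hypothesis chi_neq1 : forall x, x != 0 -> chi x != 1.

Definition hyperplane_mass (N : nat) (mu : {ffun A -> R}) (w : 'rV[A]_N) : R :=
  \sum_(c : 'cV[A]_N | (w *m c) 0 0 == 0) \prod_i mu (c i 0).

(** The bounds common to [xi] and the uniform law, so that matrices with columns of both kinds are
    treated at once. *)
Definition tame (eta Q : R) (mu : {ffun A -> R}) : Prop :=
  [/\ is_pmf mu, forall y, y != 0 -> abs_hat chi mu y <= eta &
      forall y, \sum_(x | pdvd 1 (x - y)) mu x <= Q].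

Definition stratum_count (N s : nat) (w : 'rV[A]_N) : nat :=
  #|[pred i | ~~ pdvd s (w 0 i)]|.

Lemma hyperplane_mass_ge0 N mu w : is_pmf mu -> 0 <= @hyperplane_mass N mu w.
Proof. by case=> mu_ge0 _; apply: sumr_ge0 => c _; apply: prodr_ge0. Qed.

(* Given all the other entries of [c], the equation [w *m c = 0] confines the
   entry in front of a nonzero [w 0 i] to one residue class modulo [p]. *)
Lemma hyperplane_mass_le_class (Q : R) (mu : {ffun A -> R}) (N : nat) (w : 'rV[A]_N) :
  is_pmf mu -> (forall y, \sum_(x | pdvd 1 (x - y)) mu x <= Q) -> w != 0 ->
  hyperplane_mass mu w <= Q.
Proof.
move=> [mu_ge0 mu_sum1] muQ w_neq0.
have Q_ge0 : 0 <= Q by apply: le_trans (muQ 0); apply: sumr_ge0.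
have [i wi] := exists_neq0_entry w_neq0.
pose H (c : 'cV[A]_N) := \prod_(k | k != i) mu (c k 0).
have H_ge0 c : 0 <= H c by apply: prodr_ge0.
have n_gt0 : 0 < #|A|%:R :> R by rewrite ltr0n (cardD1 0).
have sumH : \sum_c H c = #|A|%:R.
  transitivity (\prod_k \sum_x if k == i then 1 else mu x).
    rewrite -(sum_prod_entries (fun k x => if k == i then 1 else mu x)).
    apply: eq_bigr => c _; rewrite [RHS](bigD1 i) //= eqxx mul1r.
    by apply: eq_bigr => k /negPf ->.
  rewrite (bigD1 i) //= eqxx sumr_const big1 ?mulr1 // => k /negPf ->.
  exact: mu_sum1.
pose add x (c : 'cV[A]_N) := c + x *: delta_mx i 0.
have addE x c k : add x c k 0 = c k 0 + if k == i then x else 0.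
  by rewrite !mxE eqxx andbT; case: eqP; rewrite ?mulr1 ?mulr0.
have dot_add x c : (w *m add x c) 0 0 = (w *m c) 0 0 + x * w 0 i.
  by rewrite mulmxDr -scalemxAr -colE !mxE.
have H_add x c : H (add x c) = H c.
  by apply: eq_bigr => k /negPf neq_k; rewrite addE neq_k addr0.
rewrite -(ler_pM2l n_gt0).
(* Shifting entry [i] by every ring element [x] isolates that entry, at the cost of the factor
   [#|A|]. *)
have -> : #|A|%:R * hyperplane_mass mu w =
    \sum_c H c * \sum_(x | (w *m c) 0 0 + x * w 0 i == 0) mu (c i 0 + x).
  transitivity (\sum_(x : A) hyperplane_mass mu w).
    by rewrite sumr_const mulr_natl.
  under [RHS]eq_bigr do rewrite mulr_sumr big_mkcond.
  rewrite [RHS]exchange_big; apply: eq_bigr => x _.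
  rewrite /hyperplane_mass big_mkcond (reindex_inj (addIr (x *: delta_mx i 0))).
  apply: eq_bigr => c _; rewrite -/(add x c) dot_add; case: ifP => // _.
  by rewrite (bigD1 i) //= addE eqxx -/(H (add x c)) H_add mulrC.
rewrite -sumH mulr_suml; apply: ler_sum => c _; apply: ler_wpM2l => //.
have [/existsP[x0 /eqP x0P] | /existsPn none] :=
    boolP [exists x, (w *m c) 0 0 + x * w 0 i == 0]; last first.
  by rewrite big1 // => x; rewrite (negPf (none x)).
apply: le_trans (muQ (c i 0 + x0)).
rewrite [leRHS](reindex_inj (addrI (c i 0))) /= big_mkcond [leRHS]big_mkcond.
apply: ler_sum => x _; case: eqP => [xP | _]; last by case: ifP.
suff -> : pdvd 1 (c i 0 + x - (c i 0 + x0)) by [].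
rewrite opprD addrACA subrr add0r.
(* The difference of two solutions annihilates the nonzero [w 0 i], so it is not a unit. *)
have: (x - x0) * w 0 i == 0 
  by rewrite mulrBl subr_eq0; apply/eqP/(addrI ((w *m c) 0 0)); rewrite xP x0P.
apply: contraTT => x_far; apply: (mul_neq0 p_pr a_gt0 (s := a.-1)).
- by rewrite prednK.
- by rewrite prednK // pdvd_top.
- by have -> : (a - a.-1 = 1)%N by case: (a) a_gt0 => // b _; rewrite subSnn.
Qed.

(** In the sum over multipliers [t], the at most [p^s] elements of [p^(a-s) R] contribute at most 1
    each. For any other [t], at least [m0] of the products [t * w 0 i] are nonzero, and the term is
    at most [eta ^+ m0]. *)
Lemma hyperplane_mass_le_stratum (eta Q : R) (mu : {ffun A -> R}) (N s m0 : nat)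
    (w : 'rV[A]_N) :
  0 <= eta <= 1 -> tame eta Q mu -> (s < a)%N -> (m0 <= stratum_count s.+1 w)%N ->
  hyperplane_mass mu w <= (p ^ (a - s))%:R^-1 + eta ^+ m0.
Proof.
move=> /andP[eta_ge0 eta_le1] [mu_pmf mu_eta _] lt_sa le_m0.
have le_sa := ltnW lt_sa.
have n_gt0 : 0 < (p ^ a)%:R :> R by rewrite ltr0n expn_gt0 prime_gt0.
rewrite -(ler_pM2l n_gt0).
apply: le_trans (sum_prod_orth_le p_pr a_gt0 chiD norm_chi chi_neq1 (fun=> mu) w) _.
have f_ge0 := abs_hat_ge0 chi mu.
have f_le1 := abs_hat_le1 norm_chi mu_pmf.
have term t : \prod_i abs_hat chi mu (t * w 0 i) <=
    (if pdvd (a - s) t then 1 else 0) + eta ^+ m0.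
  case: ifP => st.
    apply: ler_wpDr; rewrite ?exprn_ge0 // prodr_ile1 // => i _.
    by rewrite f_ge0 f_le1.
  rewrite add0r; apply: le_trans (ler_wiXn2l eta_ge0 eta_le1 le_m0).
  rewrite -prodr_const [leRHS]big_mkcond; apply: ler_prod => i _.
  rewrite f_ge0 inE /=; case: ifP => // wi; apply: mu_eta.
  by apply: (mul_neq0 p_pr a_gt0 lt_sa) => //; rewrite st.
apply: le_trans (ler_sum _ (fun t _ => term t)) _.
rewrite big_split /= -big_mkcond !sumr_const (card_ring p_pr a_gt0) /= mulrDr.
have -> : (p ^ a)%:R * (p ^ (a - s))%:R^-1 = (p ^ s)%:R :> R.
  rewrite -{1}(subnK le_sa) expnD natrM mulrAC mulfV ?mul1r //.
  by rewrite pnatr_eq0 -lt0n expn_gt0 prime_gt0.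
rewrite mulr_natl lerD2r ler_nat -{2}(subKn le_sa).
by apply: card_pdvd; rewrite ?leq_subr.
Qed.

(** An exponential weight replaces counting: each entry outside [p^s R] costs [lam], and [lam ^- m0]
    compensates when there are fewer than [m0] of them. The weighted sum over all [w] factors. *)
Lemma sum_stratum_le (f : A -> R) (lam B : R) (N s m0 : nat) :
  (forall x, 0 <= f x <= 1) -> 0 < lam <= 1 -> \sum_(x | pdvd s x) f x <= B ->
  \sum_(w : 'rV[A]_N | (stratum_count s w < m0)%N) \prod_i f (w 0 i) <=
    lam ^- m0 * (B + lam * (p ^ a)%:R) ^+ N.
Proof.
move=> f01 /andP[lam_gt0 lam_le1] fB; have lam_ge0 := ltW lam_gt0.
pose g x := f x * if pdvd s x then 1 else lam.
have g_ge0 x : 0 <= g x.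
  by case/andP: (f01 x) => f_ge0 _; rewrite mulr_ge0 //; case: ifP.
apply: (@le_trans _ _ (lam ^- m0 * \sum_(w : 'rV[A]_N) \prod_i g (w 0 i))).
  rewrite mulr_sumr [leRHS](bigID (fun w => (stratum_count s w < m0)%N)) /=.
  apply: ler_wpDr.
    apply: sumr_ge0 => w _; rewrite mulr_ge0 ?invr_ge0 ?exprn_ge0 //.
    by apply: prodr_ge0.
  apply: ler_sum => w lt_w; rewrite big_split /=.
  rewrite mulrCA ler_peMr ?prodr_ge0 //; first by move=> i _; case/andP: (f01 (w 0 i)).
  rewrite (_ : \prod_i _ = lam ^+ stratum_count s w).
    rewrite mulrC ler_pdivlMr ?exprn_gt0 // mul1r.
    by apply: ler_wiXn2l => //; apply: ltnW.
  rewrite -prodr_const [RHS]big_mkcond; apply: eq_bigr => i _.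
  by rewrite inE /=; case: ifP.
rewrite (sum_prod_row (fun=> g)) prodr_const card_ord.
apply: ler_wpM2l; first by rewrite invr_ge0 exprn_ge0.
apply: lerXn2r; rewrite ?nnegrE ?sumr_ge0 //.
  apply: addr_ge0; last by rewrite mulr_ge0.
  by apply: le_trans fB; apply: sumr_ge0 => x _; case/andP: (f01 x).
rewrite (bigID (pdvd s)) /=; apply: lerD.
  by apply: le_trans fB; apply: ler_sum => x sx; rewrite /g sx mulr1.
apply: (@le_trans _ _ (\sum_(x : A) lam)); last first.
  by rewrite sumr_const (card_ring p_pr a_gt0) mulr_natr.
rewrite [leRHS](bigID (pdvd s)) /= ler_wpDl ?sumr_ge0 //.
apply: ler_sum => x /negPf sx; rewrite /g sx.
by case/andP: (f01 x) => ? ?; rewrite ler_piMl.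
Qed.

(** This bounds the sum of [abs_hat] over [p^s R], while [stratum_rate] bounds the hyperplane mass
    of a frequency in stratum [s]. At [s = a] the ideal is zero. *)
Definition stratum_mass (q : R) (s : nat) : R :=
  if (s < a)%N then (p ^ (a - s))%:R * q else 1.

Definition stratum_rate (q eta : R) (m0 s : nat) : R :=
  if (s < a)%N then (p ^ (a - s))%:R^-1 + eta ^+ m0 else q.

Local Notation q_of xi := (l2norm (law xi (@reduce_mod p a))).

Lemma sum_orth_le (xi : {ffun A -> R}) (eta lam : R) (N m0 : nat) (j0 : 'I_N)
    (mu : 'I_N -> {ffun A -> R}) :
  is_pmf xi -> 0 <= eta <= 1 -> 0 < lam <= 1 -> (0 < m0)%N ->
  (forall j, tame eta (q_of xi) (mu j)) ->
  \sum_(w : 'rV[A]_N | w != 0) (\prod_i abs_hat chi xi (w 0 i)) *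
     \prod_(j | j != j0) hyperplane_mass (mu j) w <=
  lam ^- m0 * \sum_(s < a.+1) (stratum_mass (q_of xi) s + lam * (p ^ a)%:R) ^+ N *
     stratum_rate (q_of xi) eta m0 s ^+ N.-1.
Proof.
set q := q_of xi.
move=> xi_pmf eta01 lam01 m0_gt0 mu_tame.
have f_ge0 := abs_hat_ge0 chi xi.
have f_le1 := abs_hat_le1 norm_chi xi_pmf.
have rate_ge0 s : 0 <= stratum_rate q eta m0 s.
  rewrite /stratum_rate; case: ifP => _; last exact: sqrtr_ge0.
  by case/andP: eta01 => ? _; rewrite addr_ge0 ?invr_ge0 ?exprn_ge0.
have mass_ge0 j (w : 'rV[A]_N) : 0 <= hyperplane_mass (mu j) w.
  by case: (mu_tame j) => mu_pmf _ _; apply: hyperplane_mass_ge0.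
have in_stratum (w : 'rV[A]_N) : w != 0 -> exists s : 'I_a.+1,
    (stratum_count s w < m0)%N /\
    forall j, hyperplane_mass (mu j) w <= stratum_rate q eta m0 s.
  move=> w_neq0; pose P s := (s <= a)%N && (stratum_count s w < m0)%N.
  (* Level 0 always qualifies, since [p^0 R] is the whole ring and [m0 > 0]. Maximality of [s < a]
     then provides [m0] entries outside [p^s.+1 R]. *)
  have P0 : exists s, P s.
    exists 0%N; rewrite /P /stratum_count eq_card0 // => i.
    by rewrite inE pdvd0.
  have P_le s : P s -> (s <= a)%N by case/andP.
  case: (ex_maxnP P0 P_le) => s /andP[le_sa lt_m0] s_max.
  exists (Ordinal (le_sa : (s < a.+1)%N)); split=> //= j.
  rewrite /stratum_rate; case: ifP => lt_sa.
    apply: (hyperplane_mass_le_stratum eta01 (mu_tame j) lt_sa).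
    rewrite leqNgt; apply/negP => lt1.
    by have := s_max s.+1; rewrite /P lt_sa lt1 ltnn => /(_ isT).
  by case: (mu_tame j) => mu_pmf _ mu_q; apply: hyperplane_mass_le_class.
pose T s (w : 'rV[A]_N) :=
  (\prod_i abs_hat chi xi (w 0 i)) * stratum_rate q eta m0 s ^+ N.-1.
have T_ge0 s (w : 'rV[A]_N) : 0 <= T s w by rewrite mulr_ge0 ?exprn_ge0 ?prodr_ge0.
(* The levels overlap; summing over all of them only overcounts nonnegative terms. *)
apply: (@le_trans _ _ (\sum_(s < a.+1)
    \sum_(w : 'rV[A]_N | (stratum_count s w < m0)%N) T s w)).
  under [leRHS]eq_bigr do rewrite big_mkcond.
  rewrite exchange_big /= big_mkcond; apply: ler_sum => w _.
  case: ifP => [w_neq0 | _]; last by apply: sumr_ge0 => s _; case: ifP.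
  have [s [lt_m0 le_rate]] := in_stratum w w_neq0.
  rewrite (bigD1 s) //= lt_m0 ler_wpDr //.
    by apply: sumr_ge0 => s' _; case: ifP.
  apply: ler_wpM2l; first by apply: prodr_ge0.
  have -> : N.-1 = #|[pred j | j != j0]| by rewrite cardC1 card_ord.
  rewrite -prodr_const; apply: ler_prod => j _.
  by rewrite mass_ge0 le_rate.
rewrite mulr_sumr; apply: ler_sum => s _.
rewrite -mulr_suml mulrA; apply: ler_wpM2r; first exact: exprn_ge0.
apply: sum_stratum_le => // [x|]; first by rewrite f_ge0 f_le1.
rewrite /stratum_mass; case: ifP => lt_sa.
  exact: (sum_abs_hat_le p_pr a_gt0 chiD norm_chi chi_neq1 xi_pmf lt_sa).
have -> : s = a :> nat.
  by apply/eqP; rewrite eqn_leq -ltnS ltn_ord leqNgt lt_sa.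
rewrite (big_pred1 0) => [|x]; last exact: (pdvd_top p_pr a_gt0 x).
by rewrite abs_hat0.
Qed.

End Strata.

(** * Comparison of one random matrix with a uniform one *)

Section SingleMatrix.

Variables (R : realType) (p a : nat).
Hypotheses (p_pr : prime p) (a_gt0 : (0 < a)%N).

Local Notation A := 'Z_(p ^ a).
Local Open Scope complex_scope.

Variable chi : A -> R[i].
Hypothesis chiD : forall x y, chi (x + y) = chi x * chi y.
Hypothesis norm_chi : forall x, `|chi x| = 1.
Hypothesis chi_neq1 : forall x, x != 0 -> chi x != 1.

Local Notation unif := (uniform R [set: A]).

Lemma uniform_pmf (T : finType) (B : {set T}) : B != set0 -> is_pmf (uniform R B).
Proof.
rewrite -card_gt0 => B_gt0; split=> [x | ].
  by rewrite ffunE; case: ifP; rewrite ?invr_ge0.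
under eq_bigr do rewrite ffunE.
by rewrite -big_mkcond sumr_const -[LHS]mulr_natl mulfV // pnatr_eq0 -lt0n.
Qed.

Lemma uniform_setTE (T : finType) x : uniform R [set: T] x = #|T|%:R^-1.
Proof. by rewrite ffunE inE cardsT. Qed.

Lemma ring_uniform_pmf : is_pmf unif.
Proof. by apply: uniform_pmf; apply/set0Pn; exists 0; rewrite inE. Qed.

Lemma hat_uniform y : y != 0 -> hat chi (fun x => (unif x)%:C) y = 0.
Proof.
move=> y_neq0; rewrite /hat; under eq_bigr do rewrite uniform_setTE.
by rewrite -mulr_sumr (sum_chi_mul chiD norm_chi chi_neq1) (negPf y_neq0) mulr0.
Qed.

Lemma uniform_tame (eta Q : R) : 0 <= eta -> p%:R^-1 <= Q -> tame chi eta Q unif.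
Proof.
move=> eta_ge0 pQ; split=> [ | y y_neq0 | y].
- exact: ring_uniform_pmf.
- by rewrite -lecR abs_hatE hat_uniform // normr0 ler0c.
apply: le_trans pQ; rewrite (reindex_inj (addIr y)) /=.
under eq_bigl do rewrite addrK.
under eq_bigr do rewrite uniform_setTE.
rewrite sumr_const card_ring // -[leLHS]mulr_natl.
rewrite ler_pdivrMr ?ltr0n ?expn_gt0 ?prime_gt0 //.
rewrite mulrC ler_pdivlMr ?ltr0n ?prime_gt0 // -natrM ler_nat.
apply: leq_trans (leq_mul (card_pdvd p_pr a_gt0 a_gt0) (leqnn p)) _.
by rewrite -expnSr subn1 prednK.
Qed.

Lemma sum_prod_pmf (mu : {ffun A -> R}) (N : nat) : is_pmf mu ->
  \sum_(c : 'cV[A]_N) \prod_i mu (c i 0) = 1.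
Proof.
by case=> _ mu1; rewrite (sum_prod_entries (fun=> mu)) big1 // => i _; apply: mu1.
Qed.

Definition col_prod (N : nat) (mu : {ffun A -> R}) (c : 'cV[A]_N) : R :=
  \prod_i mu (c i 0).

Lemma iid_mx_cols (N : nat) (mu : {ffun A -> R}) (X : 'M[A]_N) :
  iid_mx N mu X = \prod_j col_prod mu (col j X).
Proof.
rewrite ffunE exchange_big; apply: eq_bigr => j _; apply: eq_bigr => i _.
by rewrite mxE.
Qed.

Lemma uniform_mx_cols (N : nat) (X : 'M[A]_N) :
  uniform R [set: 'M[A]_N] X = \prod_j col_prod unif (col j X).
Proof.
have constN (x : R) : \prod_(i < N) x = x ^+ N by rewrite prodr_const card_ord.
rewrite uniform_setTE card_mx natrX -exprVn exprM -constN; apply: eq_bigr => j _.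
by rewrite /col_prod; under eq_bigr do rewrite uniform_setTE; rewrite constN.
Qed.

Variable xi : {ffun A -> R}.
Hypothesis xi_pmf : is_pmf xi.

Local Notation q := (l2norm (law xi (@reduce_mod p a))).

Definition matrix_bound (N : nat) (eta lam : R) (m0 : nat) : R :=
  N%:R * (lam ^- m0 * \sum_(s < a.+1)
    (stratum_mass p a q s + lam * (p ^ a)%:R) ^+ N *
    stratum_rate p a q eta m0 s ^+ N.-1).

Lemma xi_tame eta : (forall y, y != 0 -> abs_hat chi xi y <= eta) -> tame chi eta q xi.
Proof. by move=> xi_eta; split=> // y; apply: class_mass_le. Qed.

Variables (eta lam : R) (N m0 : nat).
Hypotheses (eta01 : 0 <= eta <= 1) (lam01 : 0 < lam <= 1) (m0_gt0 : (0 < m0)%N).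
Hypothesis xi_eta : forall y, y != 0 -> abs_hat chi xi y <= eta.

Variable F : 'M[A]_N -> R.
Hypothesis F01 : forall X, 0 <= F X <= 1.
Hypothesis F_inv : forall X h, \det h = 1 -> F (X *m h) = F X.

Lemma single_column_le (m : 'I_N) (mu : 'I_N -> {ffun A -> R}) :
  (forall j, tame chi eta q (mu j)) ->
  `|\sum_X (col_prod xi (col m X) - col_prod unif (col m X)) *
      (\prod_(j | j != m) col_prod (mu j) (col j X)) * F X| <=
  \sum_(w : 'rV[A]_N | w != 0) (\prod_i abs_hat chi xi (w 0 i)) *
    \prod_(j | j != m) hyperplane_mass (mu j) w.
Proof.
move=> mu_tame.
pose D (c : 'cV[A]_N) : R[i] := (col_prod xi c)%:C - (col_prod unif c)%:C.
pose nu j (c : 'cV[A]_N) : R[i] := (col_prod (mu j) c)%:C.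
have nu_ge0 j c : 0 <= nu j c.
  by rewrite ler0c prodr_ge0 // => i _; case: (mu_tame j) => -[].
have hatE (mu' : {ffun A -> R}) w : hat_col chi (fun c => (col_prod mu' c)%:C) w =
    \prod_i hat chi (fun x => (mu' x)%:C) (w 0 i).
  rewrite -(hat_col_prod chiD norm_chi); apply: eq_bigr => c _.
  by rewrite rmorph_prod.
have hatD w : hat_col chi D w = \prod_i hat chi (fun x => (xi x)%:C) (w 0 i) -
    \prod_i hat chi (fun x => (unif x)%:C) (w 0 i).
  rewrite -!hatE -sumrB; apply: eq_bigr => c _.
  by rewrite mulrBl.
have D0 : hat_col chi D 0 = 0.
  have hat0 (mu' : {ffun A -> R}) : is_pmf mu' ->
      hat chi (fun x => (mu' x)%:C) 0 = 1.
    case=> _ mu'1; rewrite /hat.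
    under eq_bigr do rewrite mulr0 (chi0 chiD norm_chi) mulr1.
    by rewrite -rmorph_sum mu'1.
  rewrite hatD !big1 ?subrr // => i _; rewrite mxE hat0 //.
  exact: ring_uniform_pmf.
have FC_le1 X : `|(F X)%:C| <= 1 :> R[i].
  by case/andP: (F01 X) => F0 F1; rewrite ger0_norm ?ler0c // lecR.
have FC_inv X h : \det h = 1 -> (F (X *m h))%:C = (F X)%:C :> R[i].
  by move=> h1; rewrite F_inv.
have := norm_sum_column_le chiD norm_chi chi_neq1 m D0 nu_ge0 FC_le1 FC_inv.
set S := \sum_X _; set T := \sum_(w | _) _.
have -> : S = (\sum_X (col_prod xi (col m X) - col_prod unif (col m X)) *
      (\prod_(j | j != m) col_prod (mu j) (col j X)) * F X)%:C.
  rewrite rmorph_sum; apply: eq_bigr => X _.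
  by rewrite !rmorphM rmorphB [X in _ = _ * X * _]rmorph_prod.
have -> : T = (\sum_(w : 'rV[A]_N | w != 0) (\prod_i abs_hat chi xi (w 0 i)) *
    \prod_(j | j != m) hyperplane_mass (mu j) w)%:C.
  rewrite rmorph_sum; apply: eq_bigr => w w_neq0.
  rewrite rmorphM !rmorph_prod; congr (_ * _).
    (* At a nonzero entry of [w] the coefficient of the uniform law is 0, so only the product for
       [xi] survives. *)
    have [i wi] := exists_neq0_entry w_neq0.
    rewrite hatD [X in _ - X](bigD1 i) //= hat_uniform // mul0r subr0 normr_prod.
    by apply: eq_bigr => k _; rewrite -abs_hatE.
  by apply: eq_bigr => j _; rewrite rmorph_sum.
rewrite -lecR; apply: le_trans.
rewrite normc_def /= expr0n addr0 sqrtr_sqr //.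
Qed.

(** Telescoping over the columns: in summand [m] the columns before [m] follow [xi] and those after
    it are uniform, all of them tame. *)
Lemma single_matrix_le :
  `|\sum_X (iid_mx N xi X - uniform R [set: 'M[A]_N] X) * F X| <=
  matrix_bound N eta lam m0.
Proof.
have unif_tame : tame chi eta q unif.
  apply: uniform_tame; first by case/andP: eta01.
  exact: inv_prime_le_l2norm.
have mix_tame (m j : 'I_N) :
    tame chi eta q (mix (fun=> xi) (fun=> unif) m j : {ffun A -> R}).
  by rewrite /mix; case: ifP => _ //; apply: xi_tame.
under eq_bigr do rewrite iid_mx_cols uniform_mx_cols prodB_telescope mulr_suml.
rewrite exchange_big /= /matrix_bound mulr_natl -[X in _ *+ X]card_ord -sumr_const.
apply: le_trans (ler_norm_sum _ _ _) (ler_sum _ _) => m _.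
apply: (le_trans _ (sum_orth_le p_pr a_gt0 chiD norm_chi chi_neq1 m xi_pmf eta01
  lam01 m0_gt0 (mix_tame m))).
apply: (le_trans _ (single_column_le m (mix_tame m))).
rewrite le_eqVlt; apply/orP; left; apply/eqP; congr (`|_|).
apply: eq_bigr => X _; congr (_ * _ * _); apply: eq_bigr => j _.
by rewrite /mix; case: ifP.
Qed.

End SingleMatrix.

Lemma exists_exprn_le (R : realType) (x e : R) : 0 <= x < 1 -> 0 < e ->
  exists2 m, (0 < m)%N & x ^+ m <= e.
Proof.
move=> /andP[x_ge0 x_lt1] e_gt0; have d_gt0 : 0 < 1 - x by rewrite subr_gt0.
(* Bernoulli's inequality in a division-free form, which covers [x = 0]. *)
have bernoulli m : x ^+ m * (1 + m%:R * (1 - x)) <= 1.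
  elim: m => [|m IHm]; first by rewrite expr0 mul0r addr0 mulr1.
  apply: le_trans IHm; rewrite exprSr -mulrA ler_wpM2l ?exprn_ge0 //.
  rewrite -subr_ge0 (_ : _ - _ = (m.+1)%:R * (1 - x) ^+ 2) ?mulr_ge0 ?(ltW d_gt0) //.
  by rewrite -natr1; ring.
pose m := Num.bound (e * (1 - x))^-1.
have m_gt : (e * (1 - x))^-1 < m%:R.
  by apply: archi_boundP; rewrite invr_ge0 mulr_ge0 // ltW.
exists m.
  by rewrite -(ltr0n R); apply: lt_trans m_gt; rewrite invr_gt0 mulr_gt0.
have em : 1 <= e * (1 + m%:R * (1 - x)).
  have: 1 <= m%:R * (e * (1 - x)).
    by rewrite -ler_pdivrMr ?mulr_gt0 // mul1r ltW.
  rewrite [e * (1 + _ * _)]mulrDr mulr1 [e * (m%:R * _)]mulrCA.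
  by move=> ?; rewrite ler_wpDl // ltW.
rewrite -(ler_pM2r (x := 1 + m%:R * (1 - x))); last first.
  by rewrite ltr_wpDr // mulr_ge0 // ltW.
exact: le_trans (bernoulli m) em.
Qed.

(** * Choice of the parameters and size of the constant *)

Section Constants.

Variables (R : realType) (p a : nat) (q eta eps : R).
Hypotheses (p_pr : prime p) (a_gt0 : (0 < a)%N).
Hypotheses (pq : p%:R^-1 <= q) (q_le1 : q <= 1) (eta01 : 0 <= eta < 1).
Hypothesis eps_gt0 : 0 < eps.

(** For [s < a] the main term is [P * q * P^-1 = q], and the two errors are each at most
    [q * d / 2]. The lower bound on the rate permits dividing by it later. *)
Lemma exists_rate_parameters :
  exists (lam : R) (m0 : nat), [/\ 0 < lam <= 1, (0 < m0)%N &
    forall s, (p ^ a)%:R^-1 <= stratum_rate p a q eta m0 s /\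
      (stratum_mass p a q s + lam * (p ^ a)%:R) * stratum_rate p a q eta m0 s <=
        q * expR (eps / 2)].
Proof.
have p_gt0 := prime_gt0 p_pr; case/andP: (eta01) => eta_ge0 eta_lt1.
pose n : R := (p ^ a)%:R; pose d := expR (eps / 2) - 1.
have n_ge1 : 1 <= n by rewrite ler1n expn_gt0 p_gt0.
have q_gt0 : 0 < q by apply: lt_le_trans pq; rewrite invr_gt0 ltr0n.
have d_gt0 : 0 < d by rewrite subr_gt0 expR_gt1 divr_gt0.
have n_gt0 : 0 < n := lt_le_trans ltr01 n_ge1.
(* The target is [eta ^+ m0 <= d / (2 * n)]. *)
have [m0 m0_gt0 le_m0] := exists_exprn_le eta01
  (divr_gt0 d_gt0 (mulr_gt0 (ltr0Sn R 1) n_gt0)).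
set h := eta ^+ m0 in le_m0.
have h_ge0 : 0 <= h by apply: exprn_ge0.
have h_le1 : h <= 1 by apply: exprn_ile1 => //; apply: ltW.
have nh : n * h <= d / 2.
  by move: le_m0; rewrite ler_pdivlMr ?mulr_gt0 // => ?; lra.
(* Rates are at most 2, so [lam * n <= q * d / 4] leaves an error of at most [q * d / 2]. *)
pose lam := Num.min 1 (q * d / (4 * n)).
have lam_gt0 : 0 < lam by rewrite lt_min ltr01 divr_gt0 ?mulr_gt0.
have lam_le1 : lam <= 1 by rewrite ge_min lexx.
have lam_n : lam * n <= q * d / 4.
  have : lam <= q * d / (4 * n) by rewrite ge_min lexx orbT.
  by rewrite ler_pdivlMr ?mulr_gt0 // => ?; lra.
have lam_n_ge0 : 0 <= lam * n by rewrite mulr_ge0 // ltW.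
exists lam, m0; split=> //; first by rewrite lam_gt0.
move=> s; rewrite -/n (_ : expR (eps / 2) = 1 + d); last by rewrite /d addrC subrK.
rewrite /stratum_rate /stratum_mass -/h; case: ifP => lt_sa; last first.
  split.
    apply: le_trans pq; rewrite /n lef_pV2 ?posrE ?ltr0n ?expn_gt0 ?p_gt0 // ler_nat.
    by rewrite -[X in (X <= _)%N]expn1 leq_exp2l ?prime_gt1.
  rewrite mulrDl mul1r mulrDr mulr1 lerD2l.
  by apply: (@le_trans _ _ (lam * n)); [rewrite ler_piMr | nra].
set P : R := (p ^ (a - s))%:R.
have P_ge1 : 1 <= P by rewrite ler1n expn_gt0 p_gt0.
have P_gt0 : 0 < P := lt_le_trans ltr01 P_ge1.
have P_le : P <= n by rewrite /P /n ler_nat leq_exp2l ?prime_gt1 // leq_subr.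
split; first by rewrite ler_wpDr // lef_pV2.
have P1 : P^-1 <= 1 by rewrite invf_le1.
have PP : P * P^-1 = 1 by rewrite mulfV ?gt_eqF.
have Ph : P * h <= d / 2 by apply: le_trans nh; rewrite ler_wpM2r.
have e1 : lam * n * (P^-1 + h) <= q * d / 4 * 2.
  apply: ler_pM => //; first by rewrite addr_ge0 // invr_ge0 ltW.
  by lra.
have e2 : q * (P * h) <= q * (d / 2) by rewrite ler_wpM2l // ltW.
rewrite mulrDl mulrDr mulrAC PP mul1r; lra.
Qed.

Lemma sum_strata_le (lam : R) (m0 N : nat) : (0 < N)%N -> 0 < lam <= 1 ->
  (forall s, (p ^ a)%:R^-1 <= stratum_rate p a q eta m0 s /\
      (stratum_mass p a q s + lam * (p ^ a)%:R) * stratum_rate p a q eta m0 s <=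
        q * expR (eps / 2)) ->
  N%:R * (lam ^- m0 * \sum_(s < a.+1)
    (stratum_mass p a q s + lam * (p ^ a)%:R) ^+ N *
    stratum_rate p a q eta m0 s ^+ N.-1) <=
  (2 / eps * lam ^- m0 * (a.+1 * p ^ a)%:R) * expR (eps * N%:R) * q ^+ N.
Proof.
move=> N_gt0 /andP[lam_gt0 _] rateP.
have q_gt0 : 0 < q by apply: lt_le_trans pq; rewrite invr_gt0 ltr0n prime_gt0.
have n_gt0 : 0 < (p ^ a)%:R :> R by rewrite ltr0n expn_gt0 prime_gt0.
set E := expR (eps / 2).
have E_gt0 : 0 < E := expR_gt0 _.
have EE : expR (eps * N%:R) = E ^+ N * E ^+ N.
  by rewrite -!expRM_natl -expRD; congr expR; field.
(* The factor [N] from the columns is absorbed by one half of the exponential, through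
   [x <= expR x]. *)
have N_le : N%:R <= 2 / eps * E ^+ N.
  have : N%:R * (eps / 2) <= E ^+ N.
    rewrite -expRM_natl; apply: le_trans (expR_ge1Dx _).
    by rewrite ler_wpDl.
  by rewrite -ler_pdivlMr ?divr_gt0 // invf_div mulrC.
have sum_le : \sum_(s < a.+1) (stratum_mass p a q s + lam * (p ^ a)%:R) ^+ N *
    stratum_rate p a q eta m0 s ^+ N.-1 <= (a.+1 * p ^ a)%:R * (q * E) ^+ N.
  apply: (@le_trans _ _ (\sum_(s < a.+1) (p ^ a)%:R * (q * E) ^+ N)); last first.
    by rewrite sumr_const card_ord natrM -mulrA [leRHS]mulr_natl.
  apply: ler_sum => s _; have [rate_ge rate_le] := rateP s.
  set r := stratum_rate _ _ _ _ _ _ in rate_ge rate_le *.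
  have r_gt0 : 0 < r by apply: lt_le_trans rate_ge; rewrite invr_gt0.
  (* One more factor [r] completes the exponent [N.-1] to [N]; since [r >= (p ^ a)^-1], this costs
     [p ^ a]. *)
  rewrite -(ler_pM2r r_gt0) -mulrA -exprSr prednK // -exprMn.
  have mass_ge0 : 0 <= stratum_mass p a q s.
    by rewrite /stratum_mass; case: ifP => _ //; rewrite mulr_ge0 // ltW.
  apply: (@le_trans _ _ ((q * E) ^+ N)).
    apply: lerXn2r; rewrite ?nnegrE ?mulr_ge0 ?addr_ge0 ?(ltW q_gt0) ?(ltW E_gt0) //.
    - by rewrite mulr_ge0 // ltW.
    - exact: ltW.
  rewrite mulrAC ler_peMl ?exprn_ge0 ?mulr_ge0 ?(ltW q_gt0) ?(ltW E_gt0) //.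
  by rewrite mulrC -ler_pdivrMr // mul1r.
have lam_ge0 : 0 <= lam ^- m0 by rewrite invr_ge0 exprn_ge0 // ltW.
apply: (@le_trans _ _ (2 / eps * E ^+ N * (lam ^- m0 *
    ((a.+1 * p ^ a)%:R * (q * E) ^+ N)))).
  apply: ler_pM => //; last by rewrite ler_wpM2l.
  apply: mulr_ge0 => //; apply: sumr_ge0 => s _.
  have [rate_ge _] := rateP s.
  rewrite mulr_ge0 ?exprn_ge0 ?addr_ge0 ?mulr_ge0 ?(ltW lam_gt0) //.
    by rewrite /stratum_mass; case: ifP => _ //; rewrite mulr_ge0 // ltW.
  by apply: le_trans rate_ge; rewrite invr_ge0.
rewrite EE exprMn le_eqVlt; apply/orP; left; apply/eqP; ring.
Qed.

End Constants.

(** * Twisting by Haar elements and telescoping over the [k] factors *)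

Lemma invmxM (A : comUnitRingType) (n : nat) (X Y : 'M[A]_n) :
  X \in unitmx -> Y \in unitmx -> invmx (X *m Y) = invmx Y *m invmx X.
Proof.
move=> XU YU; have XYU : X *m Y \in unitmx by rewrite unitmx_mul XU.
apply: (can_inj (mulKmx XYU)); rewrite mulmxV // mulmxA -(mulmxA X).
by rewrite mulmxV // mulmx1 mulmxV.
Qed.

Lemma sum_iid (R : realType) (k : nat) (T : finType) (mu : 'I_k -> T -> R) :
  \sum_(f : {ffun 'I_k -> T}) \prod_i mu i (f i) = \prod_i \sum_x mu i x.
Proof. by rewrite bigA_distr_bigA. Qed.

Section TwistedProduct.

Variables (R : realType) (A : finComUnitRingType) (N k : nat).

Local Notation V := 'M[A]_N.
Local Notation tuples := {ffun 'I_k -> V}.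
Local Notation haar := (uniform R (SL N A)).
Local Notation unif := (uniform R [set: V]).

Lemma haar_pmf : is_pmf haar.
Proof. by apply: uniform_pmf; apply/set0Pn; exists 1%:M; rewrite inE det1. Qed.

Lemma iid_haar_pmf : is_pmf (iid k haar).
Proof.
have [haar_ge0 haar_sum1] := haar_pmf; split=> [G | ].
  by rewrite ffunE prodr_ge0.
under eq_bigr do rewrite ffunE.
by rewrite (sum_iid (fun=> haar)) big1.
Qed.

Lemma iid_haar_eq0 (G : tuples) : ~~ [forall i, G i \in SL N A] -> iid k haar G = 0.
Proof.
rewrite negb_forall => /existsP[i Gi]; rewrite ffunE (bigD1 i) //= ffunE.
by rewrite (negPf Gi) mul0r.
Qed.

Lemma SL_unit (g : V) : g \in SL N A -> g \in unitmx.
Proof. by rewrite inE => /eqP; apply: unitmx_det1. Qed.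

Lemma twisted_tupleE (M G : tuples) i : twisted_tuple (M, G) i =
  if val i == 0%N then M i *m G i else invmx (G (prev_ord i)) *m M i *m G i.
Proof. by rewrite ffunE. Qed.

Variable S : {set tuples}.

(** The conditional probability of the event [S] given the matrices [M]. *)
Definition haar_average (M : tuples) : R :=
  \sum_G iid k haar G * (twisted_tuple (M, G) \in S)%:R.

Lemma haar_average_ge0 M : 0 <= haar_average M.
Proof.
by apply: sumr_ge0 => G _; rewrite mulr_ge0 ?ler0n //; case: iid_haar_pmf.
Qed.

Lemma haar_average_le1 M : haar_average M <= 1.
Proof.
have [haar_ge0 haar_sum1] := iid_haar_pmf.
rewrite -haar_sum1; apply: ler_sum => G _.
by rewrite ler_piMr // lern1 leq_b1.
Qed.

Lemma prob_law_twisted (nu : {ffun V -> R}) :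
  prob (law (indep (iid k nu) (iid k haar)) (@twisted_tuple N k A)) S =
  \sum_(M : tuples) (\prod_i nu (M i)) * haar_average M.
Proof.
rewrite /prob; under eq_bigr do rewrite ffunE /prob.
transitivity (\sum_(w : tuples * tuples | twisted_tuple w \in S)
    indep (iid k nu) (iid k haar) w).
  rewrite [RHS](partition_big (@twisted_tuple N k A) (mem S)) //=.
  apply: eq_bigr => t tS; apply: eq_bigl => w; rewrite inE.
  by case: eqP => [-> | _]; rewrite ?andbF // andbT tS.
transitivity (\sum_M \sum_G if twisted_tuple (M, G) \in S
    then indep (iid k nu) (iid k haar) (M, G) else 0).
  by rewrite pair_bigA big_mkcond; apply: eq_bigr => -[].
apply: eq_bigr => M _; rewrite mulr_sumr; apply: eq_bigr => G _.
rewrite ffunE [iid k nu M]ffunE /= mulrA.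
by case: ifP; rewrite ?mulr1 ?mulr0.
Qed.

(** For fixed invertible [G] the twist is a bijection of the tuples [M], so it preserves the uniform
    law. *)
Lemma prob_uniform_twisted :
  prob (iid k unif) S = \sum_(M : tuples) (\prod_i unif (M i)) * haar_average M.
Proof.
pose c : R := (#|V|%:R^-1) ^+ k.
have prod_unif (M : tuples) : \prod_i unif (M i) = c.
  under eq_bigr do rewrite uniform_setTE.
  by rewrite prodr_const card_ord.
have [_ haar_sum1] := iid_haar_pmf.
rewrite /prob; under eq_bigr do rewrite ffunE prod_unif.
under [RHS]eq_bigr do rewrite prod_unif mulr_sumr.
rewrite [RHS]exchange_big.
transitivity (\sum_G iid k haar G * \sum_(T in S) c).
  by rewrite -mulr_suml haar_sum1 mul1r.
apply: eq_bigr => G _.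
have [/forallP GSL | /iid_haar_eq0 G0] := boolP [forall i, G i \in SL N A]; last first.
  by rewrite G0 mul0r big1 // => M _; rewrite mul0r mulr0.
have GU i : G i \in unitmx by apply: SL_unit.
pose untwist (T : tuples) : tuples := [ffun i : 'I_k => if val i == 0%N
  then T i *m invmx (G i) else G (prev_ord i) *m T i *m invmx (G i)].
have twistK T : twisted_tuple (untwist T, G) = T.
  apply/ffunP=> i; rewrite twisted_tupleE ffunE /=; case: ifP => ->.
    by rewrite mulmxKV.
  by rewrite !mulmxA mulVmx // mul1mx mulmxKV.
have untwistK M : untwist (twisted_tuple (M, G)) = M.
  apply/ffunP=> i; rewrite ffunE twisted_tupleE /=; case: ifP => ->.
    by rewrite mulmxK.
  by rewrite !mulmxA mulmxV // mul1mx mulmxK.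
rewrite [RHS](reindex untwist); last first.
  by exists (fun M => twisted_tuple (M, G)) => T _.
rewrite mulr_sumr big_mkcond; apply: eq_bigr => T _; rewrite twistK.
by case: (T \in S); rewrite ?mulr1 ?mulr0 // mulrC.
Qed.

Section Shift.

Variables (m : 'I_k) (h : V).
Hypothesis h1 : \det h = 1.

Let hU : h \in unitmx. Proof. exact: unitmx_det1. Qed.

(** Paired with [shift_haar], this leaves the twisted tuple unchanged: [h] cancels inside [M_m G_m],
    and the [h] that enters through the inverse of [G_m] cancels against [M_(m+1)]. *)
Definition shift_mx (M : tuples) : tuples :=
  [ffun j : 'I_k => if j == m then M j *m h
                    else if val j == m.+1 then invmx h *m M j else M j].

Definition shift_haar (G : tuples) : tuples :=
  [ffun j : 'I_k => if j == m then invmx h *m G j else G j].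

Lemma shift_mx_inj : injective shift_mx.
Proof.
move=> M M' /ffunP eqM; apply/ffunP=> j; move: (eqM j); rewrite !ffunE.
case: ifP => _; first exact: (can_inj (mulmxK hU)).
by case: ifP => _ //; apply: (can_inj (mulKVmx hU)).
Qed.

Lemma shift_haar_inj : injective shift_haar.
Proof.
move=> M M' /ffunP eqM; apply/ffunP=> j; move: (eqM j); rewrite !ffunE.
by case: ifP => _ //; apply: (can_inj (mulKVmx hU)).
Qed.

Lemma det_invmx_SL : \det (invmx h) = 1.
Proof. by rewrite det_inv h1 invr1. Qed.

Lemma iid_shift_haar (G : tuples) : iid k haar (shift_haar G) = iid k haar G.
Proof.
rewrite !ffunE; apply: eq_bigr => i _; rewrite !ffunE; case: (i == m) => //.
by rewrite !inE det_mulmx det_invmx_SL mul1r.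
Qed.

Lemma twisted_shift (M G : tuples) : [forall i, G i \in SL N A] ->
  twisted_tuple (shift_mx M, shift_haar G) = twisted_tuple (M, G).
Proof.
move=> /forallP GSL; have GU i : G i \in unitmx by apply: SL_unit.
apply/ffunP=> i; rewrite !twisted_tupleE !(ffunE (fun j => if j == m then _ else _)).
have [i0 | i_neq0] := eqVneq (val i) 0%N.
  case: eqP => [-> | neq_im]; first by rewrite mulmxA mulmxK.
  by rewrite i0.
(* [prev_ord] sends 0 to 0, so this equivalence relies on [i] being nonzero. *)
have prevE : (prev_ord i == m) = (val i == m.+1).
  by rewrite -val_eqE /= -(eqn_add2r 1) !addn1 prednK // lt0n.
rewrite prevE; have [-> | neq_im] := eqVneq i m.
  by rewrite (_ : val m == m.+1 = false) ?[_ *m (M m *m h)]mulmxA;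
    [rewrite -!mulmxA mulKVmx | rewrite ltn_eqF].
case: ifP => // /eqP im1.
rewrite invmxM ?unitmx_inv // invmxK -!mulmxA.
by congr (_ *m _); rewrite mulKVmx.
Qed.

Lemma haar_average_shift M : haar_average (shift_mx M) = haar_average M.
Proof.
rewrite /haar_average (reindex_inj shift_haar_inj); apply: eq_bigr => G _.
rewrite iid_shift_haar.
have [GSL | /iid_haar_eq0 ->] := boolP [forall i, G i \in SL N A].
  by rewrite twisted_shift.
by rewrite !mul0r.
Qed.

End Shift.

Variable nu : {ffun V -> R}.
Hypothesis nu_pmf : is_pmf nu.

Lemma unif_mx_pmf : is_pmf unif.
Proof. by apply: uniform_pmf; apply/set0Pn; exists 0; rewrite inE. Qed.

(** The test function for the one-matrix comparison: conditional on the matrix in slot [m], earlier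
    slots follow [nu] and later ones are uniform. *)
Definition slot_average (m : 'I_k) (X : V) : R :=
  \sum_(M : tuples | M m == X) (\prod_(j | j != m)
    mix (fun j => nu (M j)) (fun j => unif (M j)) m j) * haar_average M.

Let mixed_ge0 (M : tuples) m j :
  0 <= mix (fun j => nu (M j)) (fun j => unif (M j)) m j.
Proof.
by rewrite /mix; case: ifP => _; [case: nu_pmf | case: unif_mx_pmf].
Qed.

Lemma slot_average01 m X : 0 <= slot_average m X <= 1.
Proof.
apply/andP; split.
  by apply: sumr_ge0 => M _; rewrite mulr_ge0 ?prodr_ge0 ?haar_average_ge0.
apply: (@le_trans _ _ (\sum_(M : tuples | M m == X) \prod_(j | j != m)
    mix (fun j => nu (M j)) (fun j => unif (M j)) m j)).
  by apply: ler_sum => M _; rewrite ler_piMr ?prodr_ge0 ?haar_average_le1.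
(* Writing the constraint [M m = X] as a factor at slot [m] makes the sum factor over the slots. *)
pose g j Y := if j == m then (Y == X)%:R else mix (fun=> nu Y) (fun=> unif Y) m j.
rewrite (_ : \sum_(_ | _) _ = \sum_(M : tuples) \prod_j g j (M j)).
  rewrite sum_iid (bigD1 m) //= {1}/g eqxx.
  rewrite (bigD1 X) //= eqxx big1 ?addr0 => [|Y /negPf ->]//.
  rewrite mul1r big1 // => j /negPf neq_j; rewrite /g neq_j /mix.
  by case: (j < m)%N; [case: nu_pmf | case: unif_mx_pmf].
rewrite big_mkcond; apply: eq_bigr => M _.
rewrite [RHS](bigD1 m) //= {1}/g eqxx; case: eqP => _; rewrite ?mul0r // mul1r.
by apply: eq_bigr => j /negPf neq_j; rewrite /g neq_j.
Qed.

(* The shift replaces [M_(m+1)] by [h^-1 M_(m+1)], which is invisible because the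
   entries after position [m] are uniform. *)
Lemma slot_average_inv m X h : \det h = 1 -> slot_average m (X *m h) = slot_average m X.
Proof.
move=> h1; have hU := unitmx_det1 h1.
rewrite /slot_average (reindex_inj (shift_mx_inj (m := m) h1)) /=.
apply: eq_big => [M | M _].
  by rewrite ffunE eqxx (inj_eq (can_inj (mulmxK hU))).
rewrite haar_average_shift //; congr (_ * _); apply: eq_bigr => j /negPf neq_j.
rewrite /mix !ffunE !inE neq_j; case: ifP => // lt_jm.
by rewrite ltn_eqF // ltnS ltnW.
Qed.

Lemma prob_twisted_telescope :
  \sum_(M : tuples) (\prod_i nu (M i)) * haar_average M -
    \sum_(M : tuples) (\prod_i unif (M i)) * haar_average M =
  \sum_m \sum_X (nu X - unif X) * slot_average m X.
Proof.
rewrite -sumrB; under eq_bigr do rewrite -mulrBl prodB_telescope mulr_suml.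
rewrite exchange_big; apply: eq_bigr => m _.
rewrite (partition_big (fun M : tuples => M m) xpredT) //=.
apply: eq_bigr => X _; rewrite mulr_sumr; apply: eq_bigr => M /eqP <-.
by rewrite mulrA.
Qed.

Lemma prob_twisted01 :
  0 <= \sum_(M : tuples) (\prod_i nu (M i)) * haar_average M <= 1.
Proof.
have [nu_ge0 nu_sum1] := nu_pmf; apply/andP; split.
  by apply: sumr_ge0 => M _; rewrite mulr_ge0 ?prodr_ge0 ?haar_average_ge0.
apply: (@le_trans _ _ (\sum_(M : tuples) \prod_i nu (M i))).
  by apply: ler_sum => M _; rewrite ler_piMr ?prodr_ge0 ?haar_average_le1.
by rewrite (sum_iid (fun=> nu)) big1.
Qed.

End TwistedProduct.

(** * Assembly of the total variation bound *)

Lemma iid_mx_pmf (R : realType) (p a N : nat) (xi : {ffun 'Z_(p ^ a) -> R}) :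
  is_pmf xi -> is_pmf (iid_mx N xi).
Proof.
move=> xi_pmf; have [xi_ge0 _] := xi_pmf; split=> [X | ].
  by rewrite ffunE; apply: prodr_ge0 => i _; apply: prodr_ge0.
under eq_bigr do rewrite iid_mx_cols.
rewrite (sum_prod_col (fun=> col_prod xi)) big1 // => j _.
exact: sum_prod_pmf.
Qed.

Lemma prob_twisted_diff_le (R : realType) (p a N k : nat) (xi : {ffun 'Z_(p ^ a) -> R})
    (B : R) (S : {set {ffun 'I_k -> 'M['Z_(p ^ a)]_N}}) : is_pmf xi ->
  (forall F : 'M['Z_(p ^ a)]_N -> R, (forall X, 0 <= F X <= 1) ->
    (forall X h, \det h = 1 -> F (X *m h) = F X) ->
    `|\sum_X (iid_mx N xi X - uniform R [set: 'M['Z_(p ^ a)]_N] X) * F X| <= B) ->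
  `|prob (law (indep (iid k (iid_mx N xi))
                     (iid k (uniform R (SL N 'Z_(p ^ a)))))
              (@twisted_tuple N k 'Z_(p ^ a))) S -
    prob (iid k (uniform R [set: 'M['Z_(p ^ a)]_N])) S| <= k%:R * B.
Proof.
move=> xi_pmf FB; have nu_pmf := iid_mx_pmf N xi_pmf.
rewrite prob_law_twisted prob_uniform_twisted prob_twisted_telescope.
apply: le_trans (ler_norm_sum _ _ _) _.
apply: (@le_trans _ _ (\sum_(m < k) B)).
  apply: ler_sum => m _; apply: FB => [X | X h h1].
    exact: slot_average01.
  exact: slot_average_inv.
by rewrite sumr_const card_ord mulr_natl.
Qed.

Lemma prob_twisted_diff_le1 (R : realType) (p a N k : nat) (xi : {ffun 'Z_(p ^ a) -> R})
    (S : {set {ffun 'I_k -> 'M['Z_(p ^ a)]_N}}) : is_pmf xi ->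
  `|prob (law (indep (iid k (iid_mx N xi))
                     (iid k (uniform R (SL N 'Z_(p ^ a)))))
              (@twisted_tuple N k 'Z_(p ^ a))) S -
    prob (iid k (uniform R [set: 'M['Z_(p ^ a)]_N])) S| <= 1.
Proof.
move=> xi_pmf; rewrite prob_law_twisted prob_uniform_twisted.
have /andP[] := prob_twisted01 S (iid_mx_pmf N xi_pmf).
have /andP[] := prob_twisted01 S (@unif_mx_pmf R 'Z_(p ^ a) N).
by move=> u0 u1 v0 v1; rewrite ler_norml; apply/andP; split; lra.
Qed.

Theorem theorem2 (R : realType) (p a : nat) (hp : prime p) (ha : (1 <= a)%N)
    (xi : {ffun 'Z_(p ^ a) -> R}) (hxi : is_pmf xi)
    (hnc : ~ concentrated_on_proper_affine_subring xi)
    (eps : R) (heps : 0 < eps) :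
  exists C : R, forall N k : nat, (1 <= N)%N -> (1 <= k)%N ->
    dTV (law (indep (iid k (iid_mx N xi))
                    (iid k (uniform R (SL N 'Z_(p ^ a)))))
             (@twisted_tuple N k 'Z_(p ^ a)))
        (iid k (uniform R [set: 'M['Z_(p ^ a)]_N]))
    < k%:R * C * expR (eps * N%:R) * l2norm (law xi (@reduce_mod p a)) ^+ N.
Proof.
set q := l2norm _.
have q_gt0 : 0 < q := l2norm_gt0 hp hxi.
have q_le1 : q <= 1 := l2norm_le1 hxi.
have pq : p%:R^-1 <= q := inv_prime_le_l2norm hp hxi.
(* Passing from [C] to [C + 1] makes the bound strict. *)
suff [C C_ge0 CP] : exists2 C : R, 0 <= C & forall N k S, (1 <= N)%N -> (1 <= k)%N ->
    `|prob (law (indep (iid k (iid_mx N xi))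
                       (iid k (uniform R (SL N 'Z_(p ^ a)))))
                (@twisted_tuple N k 'Z_(p ^ a))) S -
      prob (iid k (uniform R [set: 'M['Z_(p ^ a)]_N])) S| <=
    k%:R * (C * expR (eps * N%:R) * q ^+ N).
  exists (C + 1) => N k N_gt0 k_gt0.
  have EQ_gt0 : 0 < expR (eps * N%:R) * q ^+ N by rewrite mulr_gt0 ?expR_gt0 ?exprn_gt0.
  have k_gt0' : 0 < k%:R :> R by rewrite ltr0n.
  (* The maximum over events has default value 0, hence the separate positivity goal. *)
  rewrite -!mulrA; apply: bigmax_lt => [|S _].
    by rewrite mulr_gt0 // mulr_gt0 // ltr_wpDl.
  apply: le_lt_trans (CP N k S N_gt0 k_gt0) _.
  by rewrite -!mulrA ltr_pM2l // ltr_pM2r // ltrDl.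
(* If [q = 1], the right-hand side with [C = 1] is at least 1 and the trivial bound suffices. *)
have [q_lt1 | q_ge1] := ltP q 1; last first.
  have q1 : q = 1 by apply/eqP; rewrite eq_le q_le1.
  exists 1 => // N k S N_gt0 k_gt0; apply: le_trans (prob_twisted_diff_le1 S hxi) _.
  rewrite q1 expr1n mulr1 mul1r; apply: (@le_trans _ _ k%:R); first by rewrite ler1n.
  rewrite ler_peMr ?ler0n //; apply: le_trans (expR_ge1Dx _).
  by rewrite lerDl mulr_ge0 // ltW.
have [chi [chiD norm_chi chi_neq1]] := exists_character R[i] (modulus_gt1 hp ha).
(* A maximum over finitely many values below 1 is below 1; the default 0 is harmless because
   [abs_hat] is nonnegative. *)
pose eta := \big[Num.max/0]_(y : 'Z_(p ^ a) | y != 0) abs_hat chi xi y.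
have eta_lt1 : eta < 1.
  apply: bigmax_lt => // y y_neq0.
  exact: (abs_hat_lt1 hp ha chiD norm_chi chi_neq1 hxi).
have eta_ge0 : 0 <= eta by apply: bigmax_ge_id.
have xi_eta y : y != 0 -> abs_hat chi xi y <= eta.
  by move=> y_neq0; apply: (le_bigmax_cond _ (fun y => abs_hat chi xi y)).
have eta01 : 0 <= eta < 1 by rewrite eta_ge0.
have [lam [m0 [lam01 m0_gt0 rateP]]] :=
  exists_rate_parameters hp ha pq q_le1 eta01 heps.
exists (2 / eps * lam ^- m0 * (a.+1 * p ^ a)%:R).
  by rewrite !mulr_ge0 ?invr_ge0 ?exprn_ge0 // ltW //; case/andP: lam01.
move=> N k S N_gt0 k_gt0; apply: prob_twisted_diff_le => // F F01 F_inv.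
have eta01' : 0 <= eta <= 1 by rewrite eta_ge0 ltW.
apply: le_trans (single_matrix_le hp ha chiD norm_chi chi_neq1 hxi eta01' lam01
  m0_gt0 xi_eta F01 F_inv) _.
exact: (sum_strata_le hp pq heps N_gt0 lam01 rateP).
Qed.
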